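(* Let $r>0$ and let $\mu$ be the measure on $\mathbb{R}^q$ constructed in the context from the graph $\mathcal{G}$, the maps $(T_{i,j})$, the positive probability vector $\chi$ and the transition matrix $P=\begin{pmatrix}P_1&P_3\\P_4&P_2\end{pmatrix}$ (with $N\times N$ blocks). Assume that $P_1$ is irreducible; that for every $i\in\Psi$ both sets $\{j\in\Psi:p_{i,j}>0\}$ and $\{j\in\Psi:p_{i^+,j^+}>0\}$ have at least two elements; and that for every $(i,j)\in\Psi^2$ either $\mathcal{M}_{i,j}=\emptyset$ or $\mathcal{M}_{i,j}=\{(i,j),(i,j^+),(i^+,j),(i^+,j^+)\}$. Let $s_r$ and $t_r$ be as defined in the context. Then: (i) $D_r(\mu)$ exists, $D_r(\mu)=t_r\le s_r$, and $0<\underline{Q}_r^{t_r}(\mu)\le\overline{Q}_r^{t_r}(\mu)<\infty$; (ii) if either $p_{i,j}+p_{i,j^+}=p_{i^+,j}+p_{i^+,j^+}$ for every $(i,j)\in\mathcal{S}_2$, or $p_{i,j}+p_{i^+,j}=p_{i,j^+}+p_{i^+,j^+}$ for every $(i,j)\in\mathcal{S}_2$, then $t_r<s_r$.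
   Context: Fix integers $q\ge1$, $N\ge2$. Let $\Psi=\{1,\ldots,N\}$, $\Omega=\{1,\ldots,2N\}$, $i^+:=i+N$ for $i\in\Psi$. Let $\mathcal{G}$ be a directed graph with vertex set $\Omega$, with at most one directed edge from any vertex to any vertex and at least one edge leaving each vertex. Let $G_1=\Omega$; for $k\ge2$, $G_k$ is the set of words $\sigma\in\Omega^k$ such that there is an edge from $\sigma_h$ to $\sigma_{h+1}$ for $1\le h\le k-1$; $G_\infty$ is the set of sequences in $\Omega^{\mathbb{N}}$ with the same property for all $h\ge1$. For $(i,j)\in\Psi^2$, $\mathcal{M}_{i,j}:=\{(i,j),(i,j^+),(i^+,j),(i^+,j^+)\}\cap G_2$. For a finite word $\sigma$ over $\Psi$, $\mathcal{T}(\sigma)$ is the set of words $\widetilde\sigma$ over $\Omega$ of the same length with $\widetilde\sigma_h\in\{\sigma_h,\sigma_h^+\}$ for all $h$. Put $\mathcal{S}_1=\Psi$, $\mathcal{S}_k=\{\sigma\in\Psi^k:\mathcal{T}(\sigma)\cap G_k\ne\emptyset\}$ for $k\ge2$, and $\Gamma(\sigma)=G_n\cap\mathcal{T}(\sigma)$ for $\sigma\in\mathcal{S}_n$. $\sigma|_k$ denotes the initial segment of length $k$. Let $J_i$, $i\in\Psi$, be non-empty, pairwise disjoint compact subsets of $\mathbb{R}^q$ with $\overline{\mathrm{int}(J_i)}=J_i$, and $J_{i^+}:=J_i$. For $(i,j)\in\mathcal{S}_2$ let $T_{i,j}$ be a contractive similarity of $\mathbb{R}^q$ with ratio $s_{i,j}$,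 and let $T_{\widetilde i,\widetilde j}:=T_{i,j}$ (hence $s_{\widetilde i,\widetilde j}=s_{i,j}$) for all $(\widetilde i,\widetilde j)\in\mathcal{M}_{i,j}$. Assume that $\bigcup_{j:(i,j)\in\mathcal{S}_2}T_{i,j}(J_j)\subset J_i$ for every $i\in\Psi$, and that the sets $T_{i,j}(J_j)$, $(i,j)\in\mathcal{S}_2$, are pairwise disjoint. For $\sigma\in\mathcal{S}_n\cup G_n$ let $T_\sigma=\mathrm{id}$ and $s_\sigma=1$ if $n=1$, $T_\sigma=T_{\sigma_1,\sigma_2}\circ\cdots\circ T_{\sigma_{n-1},\sigma_n}$ and $s_\sigma=s_{\sigma_1,\sigma_2}\cdots s_{\sigma_{n-1},\sigma_n}$ if $n>1$, and $J_\sigma=T_\sigma(J_{\sigma_n})$. Let $K=\bigcap_{k\ge1}\bigcup_{\sigma\in\mathcal{S}_k}J_\sigma$. Let $\chi=(\chi_i)_{i=1}^{2N}$ be a probability vector with all entries positive and $P=(p_{i,j})_{i,j=1}^{2N}$ a row-stochastic matrix with $p_{i,j}>0$ iff $(i,j)\in G_2$. For $\widetilde\sigma\in G_n$ put $p_{\widetilde\sigma}=1$ if $n=1$ and $p_{\widetilde\sigma}=p_{\widetilde\sigma_1,\widetilde\sigma_2}\cdots p_{\widetilde\sigma_{n-1},\widetilde\sigma_n}$ if $n>1$. Let $\nu$ be the unique Borel probability measure on $G_\infty$ with $\nu(\{\widetilde\tau\in G_\infty:\widetilde\tau|_n=\widetilde\sigma\})=\chi_{\widetilde\sigma_1}p_{\widetilde\sigma}$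 for all $n$ and $\widetilde\sigma\in G_n$. Let $\pi:G_\infty\to K$, $\pi(\widetilde\sigma)$ being the unique point of $\bigcap_k J_{\widetilde\sigma|_k}$, and $\mu:=\nu\circ\pi^{-1}$. Definition of $s_r$. For $s>0$ let $A(s)$ be the $2N\times2N$ matrix whose $(i,j)$ entry is $(p_{i,j}s_{i,j}^r)^s$ if $(i,j)\in G_2$ and $0$ otherwise; let $\psi(s)$ be its spectral radius and $\rho(s)=\psi(\frac{s}{s+r})$. Then $s_r$ is the unique positive number with $\rho(s_r)=1$. Definition of $t_r$. Under the assumptions of the claim, $t_r$ is the unique positive number satisfying $$\lim_{n\to\infty}\frac1n\log\sum_{\sigma\in\mathcal{S}_n}\Big(\sum_{\widetilde\sigma\in\Gamma(\sigma)}\chi_{\widetilde\sigma_1}p_{\widetilde\sigma}s_{\widetilde\sigma}^r\Big)^{\frac{t_r}{t_r+r}}=0.$$ Quantization. For a Borel probability measure $\mu$ on $\mathbb{R}^q$ and $k\ge1$, $e_{k,r}^r(\mu)=\inf\{\int d(x,\alpha)^r\,d\mu(x):\alpha\subset\mathbb{R}^q,\ 1\le\mathrm{card}(\alpha)\le k\}$, where $d(x,\alpha)$ is the Euclidean distance. For $s>0$, $\overline{Q}_r^s(\mu)=\limsup_{k\to\infty}k^{r/s}e_{k,r}^r(\mu)$ and $\underline{Q}_r^s(\mu)=\liminf_{k\to\infty}k^{r/s}e_{k,r}^r(\mu)$. $\overline{D}_r(\mu)$ and $\underline{D}_r(\mu)$ are the $\limsup$ and $\liminf$, as $k\to\infty$,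 of $\frac{\log k}{-\log e_{k,r}(\mu)}$; if they coincide, the common value is $D_r(\mu)$. *)

(* Defs.v *)
From HB Require Import structures.
From mathcomp Require Import all_boot all_order all_algebra.
From mathcomp.real_closed Require Import complex.
From mathcomp Require Import all_classical all_reals all_analysis.
Import Order.TTheory GRing.Theory Num.Theory numFieldNormedType.Exports.

Set Implicit Arguments.
Unset Strict Implicit.
Unset Printing Implicit Defensive.

Local Open Scope classical_set_scope.
Local Open Scope ring_scope.

(* The alphabet Psi is ['I_N] and Omega is ['I_(N + N)]; the letter i of Psi is
[lshift N i] in Omega and i^+ is [rshift N i].  With this ordering of Omega the
blocks of a matrix are given by [ulsubmx], [ursubmx], [dlsubmx], [drsubmx]. *)

(* The common letter of Psi underlying i and i^+. *)
Definition base N (a : 'I_(N + N)) : 'I_N :=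
  match fintype.split a with inl i => i | inr i => i end.

(* T_{a,b} := T_{i,j} and s_{a,b} := s_{i,j} for a over i and b over j. *)
Definition doubled N V (f : 'I_N -> 'I_N -> V) (a b : 'I_(N + N)) : V :=
  f (base a) (base b).

Section Words.
Variables (N : nat) (e : rel 'I_(N + N)).

Definition Gwords n : {set n.-tuple 'I_(N + N)} := [set w : n.-tuple 'I_(N + N) | sorted e w]%SET.

Definition lifts n (u : n.-tuple 'I_N) : {set n.-tuple 'I_(N + N)} :=
  [set w | [forall h, (tnth w h == lshift N (tnth u h))
                   || (tnth w h == rshift N (tnth u h))]]%SET.

(* S_k; for k = 1 the condition is void, so that S_1 = Psi. *)
Definition Swords n : {set n.-tuple 'I_N} :=
  [set u | lifts u :&: Gwords n != finset.set0]%SET.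

Definition Gam n (u : n.-tuple 'I_N) : {set n.-tuple 'I_(N + N)} :=
  (Gwords n :&: lifts u)%SET.

Definition four_lifts (i j : 'I_N) : {set 2.-tuple 'I_(N + N)} :=
  [set [tuple lshift N i; lshift N j]; [tuple lshift N i; rshift N j];
       [tuple rshift N i; lshift N j]; [tuple rshift N i; rshift N j]]%SET.

Definition Mset (i j : 'I_N) : {set 2.-tuple 'I_(N + N)} :=
  (four_lifts i j :&: Gwords 2)%SET.

End Words.

(* f(w_1,w_2) ... f(w_{n-1},w_n), equal to 1 for words of length 1. *)
Fixpoint edge_prod (R : pzSemiRingType) I (f : I -> I -> R) (w : seq I) : R :=
  match w with
  | x :: ((y :: _) as w') => f x y * edge_prod f w'
  | _ => 1
  end.

(* T_{w_1,w_2} o ... o T_{w_{n-1},w_n}, the identity for words of length 1. *)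
Fixpoint edge_comp X I (T : I -> I -> X -> X) (w : seq I) : X -> X :=
  match w with
  | x :: ((y :: _) as w') => T x y \o edge_comp T w'
  | _ => id
  end.

Definition cylinder_set X I (T : I -> I -> X -> X) (J : I -> set X)
    n (w : n.+1.-tuple I) : set X :=
  edge_comp T w @` J (tnth w ord_max).

Definition admissible N (e : rel 'I_(N + N)) :
    set (prod_topology (fun _ : nat => discrete_topology 'I_(N + N))) :=
  [set x | forall h, e (x h) (x h.+1)].

(* G_infty, with the topology induced by the product of discrete topologies.
   [N_gt1] and [e_out] only serve to show that it is inhabited, which the
   library requires of a measurable space. *)
Definition Ginf N (N_gt1 : (1 < N)%N) (e : rel 'I_(N + N))
  (e_out : forall a, exists b, e a b) : Type := set_type (admissible e).

Section PathSpace.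
Variables (N : nat) (N_gt1 : (1 < N)%N) (e : rel 'I_(N + N)).
Hypothesis e_out : forall a, exists b, e a b.

HB.instance Definition _ :=
  Topological.copy (Ginf N_gt1 e_out) (set_type (admissible e)).

Definition some_path : nat -> 'I_(N + N) := fun h =>
  iter h (fun a => xchoose (e_out a)) (lshift N (Ordinal (ltnW N_gt1))).

Lemma some_pathP : some_path \in admissible e.
Proof. by apply/mem_set => h; exact: xchooseP. Qed.

HB.instance Definition _ := isPointed.Build (Ginf N_gt1 e_out)
  (exist _ (some_path : prod_topology _) some_pathP).

Definition prefix_word n (x : Ginf N_gt1 e_out) : n.-tuple 'I_(N + N) :=
  [tuple (val x) (h : nat) | h < n].

End PathSpace.

Notation borel T := (g_sigma_algebraType (@open T)).

(* pi(x), the unique point of the intersection of the J_{x|k}, k >= 1. *)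
Definition coding N (N_gt1 : (1 < N)%N) (e : rel 'I_(N + N))
    (e_out : forall a, exists b, e a b) (X : ptopologicalType)
    (T : 'I_N -> 'I_N -> X -> X) (J : 'I_N -> set X)
    (x : Ginf N_gt1 e_out) : X :=
  get (\bigcap_n cylinder_set (doubled T) (J \o @base N) (prefix_word n.+1 x)).

Section Euclidean.
Variables (R : realType) (q : nat).

(* The library's norm on ['rV_q] is the sup norm. *)
Definition enorm (x : 'rV[R]_q) : R := Num.sqrt (\sum_i x ord0 i ^+ 2).

Definition similarity (s : R) (f : 'rV[R]_q -> 'rV[R]_q) : Prop :=
  forall x y, enorm (f x - f y) = s * enorm (x - y).

Definition point_dist (x : 'rV[R]_q) (alpha : set 'rV[R]_q) : R :=
  inf [set enorm (x - a) | a in alpha].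

Local Open Scope ereal_scope.

Variable mu : probability (borel 'rV[R]_q) R.

(* e_{k,r}^r(mu); the values at k = 0 do not affect the limits below. *)
Definition quant_err_pow (r : R) (k : nat) : \bar R :=
  ereal_inf [set \int[mu]_x (point_dist x alpha `^ r)%:E | alpha in
    [set alpha : set 'rV[R]_q | alpha !=set0 /\ (alpha #<= `I_k)%card]].

Definition quant_err (r : R) (k : nat) : \bar R :=
  quant_err_pow r k `^ r^-1.

Definition upper_quant_coef (r s : R) : \bar R :=
  limn_esup (fun k => (k%:R `^ (r / s))%:E * quant_err_pow r k).

Definition lower_quant_coef (r s : R) : \bar R :=
  limn_einf (fun k => (k%:R `^ (r / s))%:E * quant_err_pow r k).

Definition upper_quant_dim (r : R) : \bar R :=
  limn_esup (fun k => (ln k%:R)%:E / - lne (quant_err r k)).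

Definition lower_quant_dim (r : R) : \bar R :=
  limn_einf (fun k => (ln k%:R)%:E / - lne (quant_err r k)).

(* D_r(mu) exists and equals D. *)
Definition has_quant_dim (r D : R) : Prop :=
  lower_quant_dim r = D%:E /\ upper_quant_dim r = D%:E.

End Euclidean.

Section Matrices.
Variable R : realType.

Definition spectral_radius n (A : 'M[R]_n) : R :=
  sup [set complex.Re `|z| | z in
    [set z : R[i] | eigenvalue (map_mx (real_complex R) A) z]].

(* Irreducibility of a nonnegative matrix: any two indices communicate. *)
Definition irreducible_mx n (A : 'M[R]_n) : Prop :=
  forall i j, exists2 k, (0 < k)%N & 0 < (A ^+ k) i j.

Variables (N : nat) (e : rel 'I_(N + N)).
Variables (P : 'M[R]_(N + N)) (s : 'I_N -> 'I_N -> R) (r : R).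

Definition Amx (t : R) : 'M[R]_(N + N) := \matrix_(a, b)
  (if e a b then (P a b * doubled s a b `^ r) `^ t else 0).

Definition is_s_r (sr : R) : Prop :=
  0 < sr /\ spectral_radius (Amx (sr / (sr + r))) = 1.

Variable chi : 'I_(N + N) -> R.

(* The sequence is indexed by n = (length of the words) - 1. *)
Definition is_t_r (tr : R) : Prop := 0 < tr /\
  (fun n : nat => n.+1%:R^-1 *
     ln (\sum_(u in Swords e n.+1)
           (\sum_(w in Gam e u)
              chi (thead w) * edge_prod P w * edge_prod (doubled s) w `^ r)
           `^ (tr / (tr + r)))) @ \oo --> (0 : R).

End Matrices.

(* Main.v *)
(* Put a = t_r / (t_r + r), and let h(u) be the sum over the lifts of u of the
terms chi * p * s^r.  Since every nonempty block of P is a full 2 x 2 block, all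
lifts of an admissible word are admissible, and h is quasi-multiplicative:
h(uv) is comparable to h(u) h(v).  With irreducibility and the definition of t_r,
the sums of h^a over all words of length n, or over any stopping antichain, stay
between two positive constants.  For the antichain where h first drops below eta
this means that there are about eta^(-a) cylinders, each contributing about eta to
the error; hence e_{k,r}^r is of order k^(1 - 1/a) = k^(-r/t_r).  The upper
bound puts one point in each cylinder.  For the lower bound, with twice as many
separated cylinders as points at least half of the cylinders have no point nearby.

Subadditivity of x^a bounds the sum of h^a by the entries of the powers of the
matrix A(a), which grow at most subexponentially when its spectral radius is 1;
since h decays geometrically, t_r <= s_r.  If the row sums (or column sums) agree
inside each block, the sum of p over lifts is multiplicative up to a constant, and
strict subadditivity gains a factor > 1 for each letter, which rules out
t_r = s_r. *)
Require Import Defs.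
From mathcomp Require Import all_boot all_order all_algebra.
From mathcomp.real_closed Require Import complex.
From mathcomp Require Import all_classical all_reals all_analysis.
From mathcomp Require Import measurable_realfun.
From mathcomp Require Import ring lra.
Import Order.TTheory GRing.Theory Num.Theory numFieldNormedType.Exports.

Set Implicit Arguments.
Unset Strict Implicit.
Unset Printing Implicit Defensive.

Local Open Scope classical_set_scope.
Local Open Scope ring_scope.

(** * Words and sequences of zero growth *)

Section WordLists.
Variable I : finType.

(** The obstacle is that h is a sum over lifts: it is not multiplicative, and h^a is not additive on
    the tree of words. The substitute is [word_sum], the total weight of all extensions to one
    common length. It is exactly additive along the tree, and it stays comparable to the weight
    itself as soon as the totals over words of each length are bounded above and below. This
    boundedness is more than the zero growth rate in the definition of t_r; it comes from a Fekete
    argument run in both directions.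

    The empty word carries weight 1 and has the whole space as its cylinder. Weight totals and
    integrals over cylinders are then additive functions on the same tree with the same root, so
    that one summation lemma over stopping antichains serves to count the cylinders and to split the
    error integral.

    Both comparisons of t_r with s_r rest on one contradiction: the sums of h^a are bounded below,
    whereas the powers of A(a) grow at most like theta^n for each theta > 1. A geometric gain or
    decay, however weak, decides, once theta is taken close enough to 1. *)

Fixpoint words n : seq (seq I) :=
  if n is n'.+1 then [seq i :: w | i <- enum I, w <- words n'] else [:: [::]].

Lemma sum_wordsS (V : nmodType) n (F : seq I -> V) :
  \sum_(u <- words n.+1) F u = \sum_i \sum_(u <- words n) F (i :: u).
Proof. by rewrite big_allpairs_dep big_enum. Qed.

Lemma sum_words0 (V : nmodType) (F : seq I -> V) :
  \sum_(u <- words 0) F u = F [::].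
Proof. by rewrite big_seq1. Qed.

Lemma sum_words_cat (V : nmodType) m n (F : seq I -> V) :
  \sum_(u <- words (m + n)) F u =
  \sum_(u <- words m) \sum_(v <- words n) F (u ++ v).
Proof.
elim: m F => [|m IH] F; first by rewrite sum_words0.
by rewrite addSn !sum_wordsS; apply: eq_bigr => i _; rewrite IH.
Qed.

Lemma mem_words n u : (u \in words n) = (size u == n).
Proof.
elim: n u => [|n IH] [|i u] //=.
  by apply/negbTE/negP => /allpairsP[[j v] []].
rewrite eqSS -IH; apply/allpairsP/idP => [[[j v] /= [_ vn [_ ->]]]//|un].
by exists (i, u); rewrite mem_enum.
Qed.

Lemma uniq_words n : uniq (words n).
Proof.
elim: n => //= n IH; apply: allpairs_uniq => //; first exact: enum_uniq.
by move=> [i u] [j v] _ _ [-> ->].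
Qed.

End WordLists.

Section Growth.
Variable R : realType.

(** Fekete's argument: if [y = C * x n.+1] were below 1, submultiplicativity would give
    [C * x (k.+1 * n.+1) <= y ^+ k.+1], an exponential decay along the multiples of [n.+1]. *)
Lemma supmult_zero_growth (x : nat -> R) (C : R) :
  0 < C -> (forall n, 0 < x n) ->
  (forall m n, x (m + n)%N <= C * x m * x n) ->
  (fun n : nat => n.+1%:R^-1 * ln (x n.+1)) @ \oo --> (0 : R) ->
  forall n, 1 <= C * x n.+1.
Proof.
move=> C0 x0 xM xl n; rewrite leNgt; apply/negP => y1.
set y := C * x n.+1 in y1; have y0 : 0 < y by rewrite mulr_gt0.
have pw k : C * x (k.+1 * n.+1)%N <= y ^+ k.+1.
  elim: k => [|k IH]; first by rewrite mul1n expr1.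
  rewrite mulSn exprS; apply: (le_trans (ler_wpM2l (ltW C0) (xM _ _))).
  rewrite -[C * x n.+1]/y mulrA (mulrC C) -mulrA ler_wpM2l ?(ltW y0)//.
have ly : ln y < 0 by rewrite ln_lt0// y0 y1.
pose l := - ln y; have l0 : 0 < l by rewrite /l oppr_gt0.
pose ep := l / (2 * n.+1%:R).
(* [ep] is half of the decay rate per letter, [l / n.+1]; below, [k] is large enough for the other
   half to absorb the fixed term [ln C]. *)
have ep0 : 0 < ep by rewrite divr_gt0// mulr_gt0// ltr0n.
move/cvgrPdist_lt : xl => /(_ _ ep0)[M _ HM].
pose k := maxn M (Num.truncn (`|2 * ln C / l|)).+1.
have [j Ej] : exists j, (k.+1 * n.+1 = j.+1)%N by exists (k.+1 * n.+1).-1; rewrite prednK ?muln_gt0.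
have /HM : (M <= j)%N.
  rewrite -ltnS -Ej; apply: (@leq_trans k.+1); last exact: leq_pmulr.
  by rewrite ltnS leq_maxl.
rewrite /= -Ej.
set X := x _; rewrite sub0r normrN => hX.
have kk : 2 * `|ln C| < k.+1%:R * l.
  rewrite -ltr_pdivrMr//.
  have -> : 2 * `|ln C| / l = `|2 * ln C / l|.
    by rewrite !normrM normfV (gtr0_norm l0) (ger0_norm (ler0n _ 2)).
  apply: (lt_trans (truncnS_gt _)); rewrite ltr_nat ltnS.
  exact: leq_trans (leq_maxr _ _).
have X0 : 0 < X by exact: x0.
have lX : ln X <= k.+1%:R * ln y - ln C.
  have := pw k; rewrite -[x _]/X -ler_ln ?posrE ?mulr_gt0 ?exprn_gt0//.
  by rewrite lnM ?posrE// lnXn// lerBrDl -[ln y *+ _]mulr_natl.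
have kn0 : 0 < (k.+1 * n.+1)%:R :> R by rewrite ltr0n muln_gt0.
move: hX; rewrite normrM gtr0_norm ?invr_gt0// mulrC ltr_pdivrMr//.
have -> : ep * (k.+1 * n.+1)%:R = k.+1%:R * l / 2.
  rewrite /ep natrM; field; rewrite ?pnatr_eq0//.
rewrite ltr_norml => /andP[h1 _].
have := ler_norm (- ln C); rewrite normrN => h2.
have : k.+1%:R * l = - (k.+1%:R * ln y) by rewrite /l mulrN.
lra.
Qed.

(** The upper bound is the lower bound for the sequence of inverses, which is submultiplicative with
    constant [c^-1] and also has zero growth rate. *)
Lemma quasimult_zero_growth (x : nat -> R) (c C : R) :
  0 < c -> 0 < C -> (forall n, 0 < x n) ->
  (forall m n, x (m + n)%N <= C * x m * x n) ->
  (forall m n, c * x m * x n <= x (m + n)%N) ->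
  (fun n : nat => n.+1%:R^-1 * ln (x n.+1)) @ \oo --> (0 : R) ->
  forall n, C^-1 <= x n.+1 <= c^-1.
Proof.
move=> c0 C0 x0 xC xc xl n; apply/andP; split.
  by rewrite -[C^-1]mul1r ler_pdivrMr// mulrC; exact: supmult_zero_growth xl n.
have := @supmult_zero_growth (fun n => (x n)^-1) c^-1.
rewrite invr_gt0 => /(_ c0) H.
have {H} := H (fun n => _) _ _ n; rewrite -invfM => H.
rewrite -[c^-1]mul1r ler_pdivlMr// -invf_ge1 ?mulr_gt0// mulrC H//.
- by move=> k; rewrite invr_gt0.
- by move=> k m; rewrite -!invfM lef_pV2 ?posrE ?mulr_gt0.
- rewrite [X in X @ _](_ : _ = (fun n : nat => - (n.+1%:R^-1 * ln (x n.+1)))).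
    by rewrite -oppr0; apply: cvgN.
  by apply/funext => k; rewrite lnV ?posrE// mulrN.
Qed.

End Growth.

(** The source of the uniform constants below: a property that survives shrinking its threshold
    holds for all letters at the minimum of finitely many thresholds. *)
Lemma finite_uniform_pos (R : realType) (T : finType) (Q : T -> R -> Prop) :
  (forall x d d', 0 < d' <= d -> Q x d -> Q x d') ->
  (forall x, exists2 d, 0 < d & Q x d) ->
  exists2 d, 0 < d & forall x, Q x d.
Proof.
move=> Qle Qex.
pose f x := s2val (cid2 (Qex x)).
have f0 x : 0 < f x by rewrite /f; case: cid2.
have fQ x : Q x (f x) by rewrite /f; case: cid2.
exists (\big[Order.min/1]_x f x) => [|x].
  by elim/big_ind: _ => // y z y0 z0; rewrite lt_min y0.
apply: Qle (fQ x); apply/andP; split; last exact: bigmin_le_cond.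
by elim/big_ind: _ => // y z y0 z0; rewrite lt_min y0.
Qed.

(** * Quasi-multiplicative weights on words *)

Section QuasiMultiplicative.
Variables (R : realType) (I : finType) (E : rel I) (H : seq I -> R) (c C : R).
Hypotheses (c_gt0 : 0 < c) (C_gt0 : 0 < C).
Hypothesis H_gt0 : forall u, sorted E u -> 0 < H u.
Hypothesis H_eq0 : forall u, ~~ sorted E u -> H u = 0.
Hypothesis H_nil : H [::] = 1.
Hypothesis H_cat_le : forall u v, H (u ++ v) <= C * H u * H v.
Hypothesis H_cat_ge : forall u v, sorted E (u ++ v) -> c * H u * H v <= H (u ++ v).
Hypothesis E_connected : forall i j, connect E i j.
Hypothesis E_succ : forall i, exists j, E i j.
Hypothesis I_inh : I.

(** A finite-depth stand-in for the measure of the cylinder of [u]: additive over the children of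
    [u] by [word_sumS], which [H] itself is not. *)
Definition word_sum n u := \sum_(v <- words I n) H (u ++ v).

Let Phi n := word_sum n [::].

Lemma weight_ge0 u : 0 <= H u.
Proof. by have [/H_gt0/ltW//|/H_eq0->] := boolP (sorted E u). Qed.

Lemma word_sum_ge0 n u : 0 <= word_sum n u.
Proof. by apply: sumr_ge0 => v _; exact: weight_ge0. Qed.

Lemma word_sum0 u : word_sum 0 u = H u.
Proof. by rewrite /word_sum sum_words0 cats0. Qed.

Lemma word_sumS n u : word_sum n.+1 u = \sum_j word_sum n (rcons u j).
Proof.
rewrite /word_sum sum_wordsS; apply: eq_bigr => j _; apply: eq_bigr => v _.
by rewrite cat_rcons.
Qed.

Lemma word_sumD m n u :
  word_sum (m + n) u = \sum_(v <- words I m) word_sum n (u ++ v).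
Proof.
rewrite /word_sum sum_words_cat; apply: eq_bigr => v _; apply: eq_bigr => w _.
by rewrite catA.
Qed.

Lemma word_sum_le n u : word_sum n u <= C * H u * Phi n.
Proof.
rewrite mulr_sumr; apply: ler_sum => v _; exact: H_cat_le.
Qed.

Lemma word_sum_nilD_le m n : Phi (m + n) <= C * Phi m * Phi n.
Proof.
rewrite /Phi word_sumD [_ * word_sum m _]mulr_sumr mulr_suml; apply: ler_sum => u _.
exact: word_sum_le.
Qed.

Lemma word_sum_nilS n : Phi n.+1 = \sum_i word_sum n [:: i].
Proof. by rewrite /Phi word_sumS. Qed.

Lemma word_sum_cons n u j : sorted E (rcons u j) ->
  c * H u * word_sum n [:: j] <= word_sum n (rcons u j).
Proof.
move=> uj; rewrite mulr_sumr /word_sum; apply: ler_sum => v _.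
have [jv|/H_eq0->] := boolP (sorted E ([:: j] ++ v)); last first.
  by rewrite mulr0 weight_ge0.
rewrite cat_rcons -cat1s; apply: H_cat_ge.
by case: u uj => //= i u; rewrite cat_path rcons_path /= => /andP[-> ->].
Qed.

Lemma word_sum_rcons_le n u i : sorted E (rcons u i) ->
  word_sum n (rcons u i) <= word_sum n.+1 u.
Proof.
by move=> _; rewrite word_sumS (bigD1 i)//= lerDl sumr_ge0// => *; exact: word_sum_ge0.
Qed.

Lemma word_sum_start_gt0 n i : 0 < word_sum n [:: i].
Proof.
elim: n i => [|n IH] i; first by rewrite word_sum0 H_gt0.
have [j ij] := E_succ i; have sij : sorted E (rcons [:: i] j) by rewrite /= ij.
apply: lt_le_trans (word_sum_rcons_le n sij); apply: lt_le_trans (word_sum_cons n sij).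
by rewrite !mulr_gt0// H_gt0.
Qed.

Lemma word_sum_nil_gt0 n : 0 < Phi n.
Proof.
case: n => [|n]; first by rewrite /Phi word_sum0 H_nil.
rewrite word_sum_nilS (bigD1 I_inh)//= ltr_wpDr ?word_sum_start_gt0//.
by apply: sumr_ge0 => i _; exact: word_sum_ge0.
Qed.

(** Putting [i] in front of the extensions of [j] yields words with one letter too many; dropping
    the last letter costs the factor [C * Phi 1]. *)
Lemma word_sum_start_step : exists2 d, 0 < d &
  forall i j n, E i j -> d * word_sum n [:: j] <= word_sum n [:: i].
Proof.
have [d d0 dH] : exists2 d, 0 < d & forall i, d <= H [:: i].
  apply: finite_uniform_pos => [x d d' /andP[_ /le_trans]|i]; first exact.
  by exists (H [:: i]); rewrite ?H_gt0.
have S0 : 0 < Phi 1 by exact: word_sum_nil_gt0.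
exists (c * d / (C * Phi 1)) => [|i j n ij]; first by rewrite !(divr_gt0, mulr_gt0).
rewrite mulrAC ler_pdivrMr ?mulr_gt0//.
have sij : sorted E (rcons [:: i] j) by rewrite /= ij.
apply: (@le_trans _ _ (word_sum n.+1 [:: i])).
  apply: le_trans (word_sum_rcons_le n sij); apply: le_trans (word_sum_cons n sij).
  by rewrite ler_wpM2r ?word_sum_ge0// ler_wpM2l// ltW.
rewrite -addn1 word_sumD [leRHS]mulr_suml.
by apply: ler_sum => v _; rewrite mulrCA mulrA; exact: word_sum_le.
Qed.

(* Walking along a path from [i] to [j] costs a factor that does not depend on [n]. *)
Lemma word_sum_start_comparable : exists2 d, 0 < d &
  forall i j n, d * word_sum n [:: j] <= word_sum n [:: i].
Proof.
have [d d0 dE] := word_sum_start_step.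
have [e e0 He] : exists2 e, 0 < e & forall ij : I * I, forall n,
    e * word_sum n [:: ij.2] <= word_sum n [:: ij.1].
  apply: finite_uniform_pos => [x e e' /andP[_ ee] Hx n|[i j]].
    by apply: le_trans (Hx n); rewrite ler_wpM2r ?word_sum_ge0.
  have /connectP[p pp ->{j}] /= := E_connected i j.
  exists (d ^+ size p) => [|n]; first exact: exprn_gt0.
  elim: p i pp => [|j p IH] i /=; first by rewrite mul1r.
  move=> /andP[ij /IH {}IH]; rewrite exprS -mulrA.
  by apply: le_trans (dE _ _ n ij); rewrite ler_wpM2l// ltW.
by exists e => // i j; exact: (He (i, j)).
Qed.

Lemma word_sum_ge : exists2 d, 0 < d & forall n u, d * H u * Phi n <= word_sum n u.
Proof.
have [d d0 dE] := word_sum_start_comparable.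
have I0 : 0 < #|I|%:R :> R by rewrite ltr0n; apply/card_gt0P; exists I_inh.
(* One of the [n.+1] letters is spent on a single successor [j] of [u]. Since all first letters are
   comparable, the extensions of [j] carry at least the fraction [d / #|I|] of [Phi n.+1]. *)
have key n u : c * d / #|I|%:R * H u * Phi n.+1 <= word_sum n.+1 u.
  have [uE|/H_eq0->] := boolP (sorted E u); last by rewrite mulr0 mul0r word_sum_ge0.
  have [j uj] : exists j, sorted E (rcons u j).
    case: u uE => [|i u] /=; first by exists I_inh.
    by have [j ij] := E_succ (last i u); exists j; rewrite rcons_path uE.
  apply: le_trans (word_sum_rcons_le n uj); apply: le_trans (word_sum_cons n uj).
  have -> : c * d / #|I|%:R * H u * Phi n.+1 = c * H u * (d * Phi n.+1 / #|I|%:R) by ring.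
  rewrite ler_wpM2l ?(mulr_ge0 (ltW c_gt0)) ?weight_ge0// ler_pdivrMr//.
  rewrite word_sum_nilS mulr_sumr -sum1_card natr_sum [leRHS]mulr_sumr.
  by apply: ler_sum => i _; rewrite mulr1; exact: dE.
exists (Order.min 1 (c * d / #|I|%:R)) => [|n u].
  by rewrite lt_min ltr01 divr_gt0// mulr_gt0.
case: n => [|n].
  by rewrite /Phi !word_sum0 H_nil mulr1 ler_piMl ?weight_ge0// ge_min lexx.
apply: le_trans (key n u); rewrite !ler_wpM2r ?word_sum_ge0 ?weight_ge0//.
by rewrite ge_min lexx orbT.
Qed.

Hypothesis Phi_growth : (fun n : nat => n.+1%:R^-1 * ln (Phi n.+1)) @ \oo --> (0 : R).

Lemma word_sum_bounds : exists d D, [/\ 0 < d, 0 < D &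
  forall n u, d * H u <= word_sum n u <= D * H u].
Proof.
have [d d0 dE] := word_sum_ge.
have Phi_ge m n : d * Phi m * Phi n <= Phi (m + n).
  rewrite /Phi word_sumD [_ * word_sum m _]mulr_sumr mulr_suml; apply: ler_sum => u _; exact: dE.
(* The growth lemma speaks of positive lengths only; the bounds by 1 account for [Phi 0 = 1]. *)
have PhiB n : Order.min 1 C^-1 <= Phi n <= Order.max 1 d^-1.
  case: n => [|n]; first by rewrite /Phi word_sum0 H_nil ge_min le_max lexx.
  have /andP[] := @quasimult_zero_growth R Phi d C d0 C_gt0 word_sum_nil_gt0
    word_sum_nilD_le Phi_ge Phi_growth n.
  by rewrite ge_min le_max => -> ->; rewrite !orbT.
have m0 : 0 < Order.min 1 C^-1 by rewrite lt_min ltr01 invr_gt0.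
have M0 : 0 < Order.max 1 d^-1 by rewrite lt_max ltr01.
exists (d * Order.min 1 C^-1), (C * Order.max 1 d^-1); split; rewrite ?mulr_gt0//.
move=> n u; have /andP[h1 h2] := PhiB n; apply/andP; split.
  by apply: le_trans (dE n u); rewrite mulrAC ler_wpM2l// mulr_ge0 ?weight_ge0// ltW.
apply: le_trans (word_sum_le n u) _.
by rewrite [leRHS]mulrAC ler_wpM2l// mulr_ge0 ?weight_ge0// ltW.
Qed.

End QuasiMultiplicative.

Definition incomparable (I : eqType) (u v : seq I) :=
  ~~ prefix u v && ~~ prefix v u.

Lemma prefix_rcons_neq (I : eqType) (u v w : seq I) i j : i != j ->
  prefix (rcons u i) v -> prefix (rcons u j) w -> ~~ prefix v w.
Proof.
move=> ij uv uw; apply: contra ij => vw.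
have := prefix_trans uv vw; move: uw; rewrite !prefixE => /eqP + /eqP.
by rewrite !size_rcons => -> /rcons_inj[->].
Qed.

Lemma incomparable_same_size (I : eqType) (u v : seq I) : size u = size v -> u != v -> incomparable u v.
Proof.
move=> uv n; rewrite /incomparable !prefixE {1}uv take_size -uv take_size.
by rewrite eq_sym n.
Qed.

(** * Stopping antichains *)

Section StoppingTree.
Variables (R : realType) (I : finType) (E : rel I) (h : seq I -> R) (eta : R).

(* [n] is fuel: a branch is cut after [n] letters even if [h] has not dropped
below [eta]. *)
Fixpoint stop n u : seq (seq I) :=
  if n is n'.+1 then
    if h u < eta then [:: u]
    else flatten [seq stop n' (rcons u j) | j <- enum I & sorted E (rcons u j)]
  else [:: u].

(** Length plus fuel is the constant [L], so only words shorter than [L] are ever split. This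
    permits a [G] that is additive only up to length [L], such as [word_sum] at depth
    [L - size u]. *)
Lemma stop_sum (V : nmodType) (G : seq I -> V) (L : nat) :
  (forall u, sorted E u -> (size u < L)%N ->
     G u = \sum_(j | sorted E (rcons u j)) G (rcons u j)) ->
  forall n u, (size u + n)%N = L -> sorted E u -> \sum_(v <- stop n u) G v = G u.
Proof.
move=> GE; elim => [|n IH] u uL uE /=; first by rewrite big_seq1.
case: ifPn => _; first by rewrite big_seq1.
rewrite big_flatten big_map big_filter big_enum_cond /= GE//; last first.
  by rewrite -uL addnS ltnS leq_addr.
apply: eq_bigr => j uj.
by rewrite IH ?size_rcons ?addSnnS.
Qed.

Lemma stop_prefix n u v : v \in stop n u -> prefix u v.
Proof.
elim: n u => [|n IH] u /=; first by rewrite inE => /eqP->; rewrite prefix_refl.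
case: ifPn => _; first by rewrite inE => /eqP->; rewrite prefix_refl.
move=> /flatten_mapP[j _ /IH]; apply: prefix_trans; exact: prefix_rcons.
Qed.

Lemma stop_sorted n u v : sorted E u -> v \in stop n u -> sorted E v.
Proof.
elim: n u => [|n IH] u uE /=; first by rewrite inE => /eqP->.
case: ifPn => _; first by rewrite inE => /eqP->.
by move=> /flatten_mapP[j + /IH]; rewrite mem_filter => /andP[uj _]; apply.
Qed.

(** With [L] so large that [h] is below [eta] on every word of length [L], even a branch cut for
    want of fuel ends below [eta]. *)
Lemma stop_lt L n u v :
  (forall u, sorted E u -> size u = L -> h u < eta) ->
  (size u + n)%N = L -> sorted E u -> v \in stop n u -> h v < eta.
Proof.
move=> hL; elim: n u => [|n IH] u uL uE /=.
  by rewrite inE => /eqP->; apply: hL; rewrite // -uL addn0.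
case: ifPn => [? |_]; first by rewrite inE => /eqP->.
move=> /flatten_mapP[j]; rewrite mem_filter => /andP[uj _].
by apply: IH; rewrite ?size_rcons ?addSnnS.
Qed.

(** A leaf below the root has a parent with [h] at least [eta], and one more letter costs at most
    the factor [b]. *)
Lemma stop_ge b n u v :
  (forall u j, sorted E (rcons u j) -> b * h u <= h (rcons u j)) -> 0 <= b ->
  b * eta <= h u -> v \in stop n u -> b * eta <= h v.
Proof.
move=> hb b0; elim: n u => [|n IH] u uL /=.
  by rewrite inE => /eqP->.
case: ifPn => [? |]; first by rewrite inE => /eqP->.
rewrite -leNgt => hu /flatten_mapP[j]; rewrite mem_filter => /andP[uj _].
by apply: IH; apply: le_trans (hb _ _ uj); rewrite ler_wpM2l.
Qed.

Lemma stop_incomparable n u : pairwise (@incomparable I) (stop n u).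
Proof.
elim: n u => [|n IH] u //=; case: ifPn => // _.
have : uniq [seq j <- enum I | sorted E (rcons u j)].
  by rewrite filter_uniq// enum_uniq.
elim: [seq _ <- _ | _] => //= j js IHjs /andP[jjs ujs].
rewrite pairwise_cat IH IHjs// !andbT; apply/allrelP => v w /stop_prefix jv.
move=> /flatten_mapP[i ijs /stop_prefix iw].
have ij : i != j by apply: contraNneq jjs => <-.
have ji : j != i by rewrite eq_sym.
by rewrite /incomparable (prefix_rcons_neq ij iw jv) (prefix_rcons_neq ji jv iw).
Qed.

End StoppingTree.

Section StoppingFamily.
Variables (R : realType) (I : finType) (E : rel I) (h : seq I -> R) (c C a : R).
Hypotheses (c_gt0 : 0 < c) (C_gt0 : 0 < C) (a_gt0 : 0 < a).
Hypothesis h_gt0 : forall u, sorted E u -> 0 < h u.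
Hypothesis h_nil : h [::] = 1.
Hypothesis h_cat_le : forall u v, sorted E (u ++ v) -> h (u ++ v) <= C * h u * h v.
Hypothesis h_cat_ge : forall u v, sorted E (u ++ v) -> c * h u * h v <= h (u ++ v).
Hypothesis h_small : forall eta, 0 < eta ->
  exists L, forall u, sorted E u -> size u = L -> h u < eta.
Hypothesis E_connected : forall i j, connect E i j.
Hypothesis E_succ : forall i, exists j, E i j.
Hypothesis I_inh : I.

(** Extended by 0 to inadmissible words, so that sums can run over all words of a given length. *)
Definition pow_weight u := if sorted E u then h u `^ a else 0.

Lemma sorted_cat_lr u v : sorted E (u ++ v) -> sorted E u /\ sorted E v.
Proof.
case: u => [|i u] //=; rewrite cat_path => /andP[-> /path_sorted]; by split.
Qed.

Lemma pow_weight_gt0 u : sorted E u -> 0 < pow_weight u.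
Proof. by rewrite /pow_weight => uE; rewrite uE powR_gt0// h_gt0. Qed.

Lemma pow_weight_eq0 u : ~~ sorted E u -> pow_weight u = 0.
Proof. by rewrite /pow_weight => /negbTE->. Qed.

Lemma pow_weight_nil : pow_weight [::] = 1.
Proof. by rewrite /pow_weight /= h_nil powR1. Qed.

Lemma pow_weight_cat_le u v :
  pow_weight (u ++ v) <= C `^ a * pow_weight u * pow_weight v.
Proof.
rewrite /pow_weight; case: ifPn => [uv|_]; last first.
  by rewrite !mulr_ge0 ?powR_ge0//; case: ifP => // _; rewrite powR_ge0.
have [uE vE] := sorted_cat_lr uv; rewrite uE vE.
have [u0 v0] := (h_gt0 uE, h_gt0 vE).
rewrite -!powRM ?mulr_ge0 ?(ltW C_gt0) ?(ltW u0) ?(ltW v0)//.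
apply: ge0_ler_powR; rewrite ?(ltW a_gt0)// ?nnegrE.
- by rewrite ltW// h_gt0.
- by rewrite !mulr_ge0// ltW.
- exact: h_cat_le.
Qed.

Lemma pow_weight_cat_ge u v : sorted E (u ++ v) ->
  c `^ a * pow_weight u * pow_weight v <= pow_weight (u ++ v).
Proof.
move=> uv; rewrite /pow_weight uv; have [uE vE] := sorted_cat_lr uv; rewrite uE vE.
have [u0 v0] := (h_gt0 uE, h_gt0 vE).
rewrite -!powRM ?mulr_ge0 ?(ltW c_gt0) ?(ltW u0) ?(ltW v0)//.
apply: ge0_ler_powR; rewrite ?(ltW a_gt0)// ?nnegrE.
- by rewrite !mulr_ge0// ltW.
- by rewrite ltW// h_gt0.
- exact: h_cat_ge.
Qed.

Hypothesis growth : (fun n : nat => n.+1%:R^-1 *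
  ln (\sum_(u <- words I n.+1) pow_weight u)) @ \oo --> (0 : R).

Lemma pow_weight_sum_bounds : exists d D, [/\ 0 < d, 0 < D & forall n u,
  d * pow_weight u <= word_sum pow_weight n u <= D * pow_weight u].
Proof.
have ca0 : 0 < c `^ a by rewrite powR_gt0.
have Ca0 : 0 < C `^ a by rewrite powR_gt0.
exact: (word_sum_bounds ca0 Ca0 pow_weight_gt0 pow_weight_eq0
  pow_weight_nil pow_weight_cat_le pow_weight_cat_ge E_connected E_succ I_inh growth).
Qed.

Lemma pow_weight_sum_ge : exists2 d, 0 < d &
  forall n, d <= \sum_(u <- words I n) pow_weight u.
Proof.
have [d [D [d0 _ dD]]] := pow_weight_sum_bounds; exists d => // n.
by have /andP[+ _] := dD n [::]; rewrite pow_weight_nil mulr1.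
Qed.

(** The count follows by writing the total [G [::]], which lies in [[d, D]], as a sum over the
    leaves, each of weight comparable to [eta] to the power [a]. The last clause will be applied to
    integrals over cylinders. The bound [eta <= 1] keeps the root, of weight 1, from being a
    leaf. *)
Lemma stopping_family : exists c' C', [/\ 0 < c', 0 < C' &
  forall eta, 0 < eta <= 1 -> exists Lam : seq (seq I),
  [/\ pairwise (@incomparable I) Lam,
      forall u, u \in Lam -> [/\ u != [::], sorted E u & c' * eta <= h u < eta],
      c' <= (size Lam)%:R * eta `^ a <= C' &
      forall G : seq I -> \bar R,
        (forall u, sorted E u ->
           G u = (\sum_(j | sorted E (rcons u j)) G (rcons u j))%E) ->
        G [::] = (\sum_(u <- Lam) G u)%E]].
Proof.
have [d [D [d0 D0 dD]]] := pow_weight_sum_bounds.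
have [e1 e10 e1h] : exists2 d, 0 < d & forall i, d <= h [:: i].
  apply: finite_uniform_pos => [x e e' /andP[_ /le_trans]|i]; first exact.
  by exists (h [:: i]); rewrite ?h_gt0.
(* [c * e1] bounds the loss from one more letter; the minimum with 1 gives [b * eta <= 1 = h [::]],
   the start of the induction in [stop_ge]. *)
pose b := Order.min 1 (c * e1).
have b0 : 0 < b by rewrite lt_min ltr01 mulr_gt0.
have hb u j : sorted E (rcons u j) -> b * h u <= h (rcons u j).
  move=> uj; have uE : sorted E u by move: uj; rewrite -cats1 => /sorted_cat_lr[].
  rewrite -cats1; apply: (le_trans _ (@h_cat_ge u [:: j] _)); last by rewrite cats1.
  rewrite mulrAC ler_wpM2r ?(ltW (h_gt0 uE))//.
  by apply: (@le_trans _ _ (c * e1)); rewrite ?ge_min ?lexx ?orbT// ler_wpM2l// ltW.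
(* One constant for two purposes: [b] bounds the weights of the leaves from below, [d / D] their
   number. *)
pose c' := Order.min b (d / D).
have c'0 : 0 < c' by rewrite lt_min b0 divr_gt0.
exists c', (D / d / b `^ a); split => //.
  by rewrite divr_gt0 ?divr_gt0// powR_gt0.
move=> eta /andP[eta0 eta1]; have [L hL] := h_small eta0.
have L0 : (0 < L)%N.
  by case: L hL => // /(_ [::] isT erefl); rewrite h_nil ltNge eta1.
have L00 : (size (@nil I) + L)%N = L by rewrite add0n.
exists (stop E h eta L [::]).
have LE u : u \in stop E h eta L [::] -> [/\ u != [::], sorted E u & b * eta <= h u < eta].
  move=> uL; have hu := stop_lt hL L00 isT uL; split.
  - by apply: contraTneq hu => ->; rewrite h_nil -leNgt.
  - exact: stop_sorted uL.
  - rewrite hu andbT; apply: stop_ge hb (ltW b0) _ uL.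
    by rewrite h_nil; apply: mulr_ile1; rewrite ?(ltW b0) ?(ltW eta0)// ge_min lexx.
split.
- exact: stop_incomparable.
- move=> u /LE[-> -> /andP[h1 ->]]; split => //; rewrite andbT.
  by apply: le_trans h1; rewrite ler_wpM2r ?(ltW eta0)// ge_min lexx.
- (* Summing the weights over the extensions to the fixed length [L] is exactly
  additive on the tree, and comparable to the weight itself. *)
  pose G u := word_sum pow_weight (L - size u) u.
  have GE u : sorted E u -> (size u < L)%N ->
     G u = \sum_(j | sorted E (rcons u j)) G (rcons u j).
    move=> uE uL; rewrite /G -(subnSK uL) word_sumS [in RHS]big_mkcond/=.
    apply: eq_bigr => j _; rewrite size_rcons; case: ifPn => // uj.
    apply: big1 => v _; apply: pow_weight_eq0; apply: contra uj.
    by move=> /sorted_cat_lr[].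
  have sG := stop_sum h eta GE L00 isT.
  have /andP[g1 g2] : d <= G [::] <= D.
    by have := dD (L - 0)%N [::]; rewrite pow_weight_nil !mulr1.
  have pwE u : u \in stop E h eta L [::] -> pow_weight u = h u `^ a.
    by move=> /LE[_ uE _]; rewrite /pow_weight uE.
  have const (x : R) : \sum_(u <- stop E h eta L [::]) x =
      (size (stop E h eta L [::]))%:R * x.
    by rewrite big_const_seq count_predT iter_addr_0 mulr_natl.
  apply/andP; split.
    apply: (@le_trans _ _ (d / D)); first by rewrite ge_min lexx orbT.
    rewrite ler_pdivrMr//; apply: (le_trans g1).
    rewrite -sG -mulrA -const big_seq [leRHS]big_seq; apply: ler_sum => u uL.
    have /andP[_ /le_trans] := dD (L - size u)%N u; apply.
    rewrite mulrC ler_wpM2r ?(ltW D0)// pwE//; have [_ uE /andP[_ hu]] := LE _ uL.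
    by rewrite ge0_ler_powR ?nnegrE ?(ltW a_gt0) ?(ltW eta0) ?(ltW hu)// ltW// h_gt0.
  rewrite ler_pdivlMr ?powR_gt0// ler_pdivlMr//; apply: le_trans g2.
  rewrite -!mulrA -const -sG big_seq [leRHS]big_seq; apply: ler_sum => u uL.
  have /andP[+ _] := dD (L - size u)%N u; apply: le_trans.
  rewrite [leLHS]mulrA mulrC ler_wpM2l ?(ltW d0)// pwE//; have [_ uE /andP[hu _]] := LE _ uL.
  rewrite mulrC -powRM ?(ltW b0) ?(ltW eta0)//.
  by rewrite ge0_ler_powR ?nnegrE ?(ltW a_gt0)// ?mulr_ge0 ?(ltW b0) ?(ltW eta0)// ltW// h_gt0.
- by move=> G GE; rewrite (stop_sum h eta _ L00)// => u /GE.
Qed.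

End StoppingFamily.

(** * Lifted words and their energies *)

Section EdgeProducts.
Variables (R : realType) (I : finType) (E : rel I).
Implicit Types (f : I -> I -> R) (u v : seq I).

Lemma edge_prod_cons f i j u :
  edge_prod f (i :: j :: u) = f i j * edge_prod f (j :: u).
Proof. by []. Qed.

Lemma edge_prod_cat f i u j v :
  edge_prod f ((i :: u) ++ (j :: v)) =
  edge_prod f (i :: u) * f (last i u) j * edge_prod f (j :: v).
Proof.
elim: u i => [|k u IH] i; first by rewrite /= mul1r.
by rewrite !cat_cons !edge_prod_cons -cat_cons IH !mulrA.
Qed.

Lemma edge_prod_ge0 f u : (forall i j, E i j -> 0 <= f i j) ->
  sorted E u -> 0 <= edge_prod f u.
Proof.
move=> f0; case: u => //= i u; elim: u i => //= j u IH i /andP[ij ju].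
by rewrite mulr_ge0 ?f0// IH.
Qed.

Lemma edge_prod_gt0 f u : (forall i j, E i j -> 0 < f i j) ->
  sorted E u -> 0 < edge_prod f u.
Proof.
move=> f0; case: u => //= i u; elim: u i => //= j u IH i /andP[ij ju].
by rewrite mulr_gt0 ?f0// IH.
Qed.

Lemma edge_prodM f g u :
  edge_prod (fun i j => f i j * g i j) u = edge_prod f u * edge_prod g u.
Proof.
case: u => [|i u]; first by rewrite /= mulr1.
elim: u i => [|j u IH] i; first by rewrite /= mulr1.
by rewrite !edge_prod_cons IH mulrACA.
Qed.

Lemma edge_prod_powR f a u : (forall i j, E i j -> 0 <= f i j) ->
  sorted E u -> edge_prod (fun i j => f i j `^ a) u = edge_prod f u `^ a.
Proof.
move=> f0; case: u => [|i u]; first by rewrite /= powR1.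
elim: u i => [|j u IH] i; first by rewrite /= powR1.
rewrite [sorted _ _]/= => /andP[ij ju]; rewrite !edge_prod_cons IH// powRM ?f0//.
exact: (edge_prod_ge0 f0 (u := j :: u)).
Qed.

Lemma edge_prod_eq f g u : (forall i j, E i j -> f i j = g i j) ->
  sorted E u -> edge_prod f u = edge_prod g u.
Proof.
move=> fg; case: u => //= i u; elim: u i => //= j u IH i /andP[ij ju].
by rewrite fg// IH.
Qed.

(** The two sides differ only by the factor on the edge joining [u] to [v]; the same holds in
    [edge_prod_cat_ge]. *)
Lemma edge_prod_cat_le f u v : (forall i j, E i j -> 0 <= f i j <= 1) ->
  sorted E (u ++ v) -> edge_prod f (u ++ v) <= edge_prod f u * edge_prod f v.
Proof.
move=> f01 uv; have [uE vE] := sorted_cat_lr uv.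
have f0 i j : E i j -> 0 <= f i j by move=> /f01/andP[].
case: u uv uE => [|i u] uv uE; first by rewrite mul1r.
case: v uv vE => [|j v] uv vE; first by rewrite cats0 mulr1.
rewrite edge_prod_cat ler_wpM2r ?edge_prod_ge0// ler_piMr ?edge_prod_ge0//.
by move: uv; rewrite /= cat_path /= => /and3P[_ /f01/andP[]].
Qed.

Lemma edge_prod_cat_ge f k u v : 0 <= k <= 1 ->
  (forall i j, E i j -> k <= f i j) ->
  sorted E (u ++ v) -> k * edge_prod f u * edge_prod f v <= edge_prod f (u ++ v).
Proof.
move=> /andP[k0 k1] fk uv; have [uE vE] := sorted_cat_lr uv.
have f0 i j : E i j -> 0 <= f i j by move=> /fk; apply: le_trans.
case: u uv uE => [|i u] uv uE; first by rewrite mulr1 ler_piMl ?edge_prod_ge0.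
case: v uv vE => [|j v] uv vE; first by rewrite cats0 mulr1 ler_piMl ?edge_prod_ge0.
rewrite edge_prod_cat ler_wpM2r ?edge_prod_ge0// mulrC ler_wpM2l ?edge_prod_ge0//.
by move: uv; rewrite /= cat_path /= => /and3P[_ /fk].
Qed.

Lemma edge_prod_le_expr f k u : (forall i j, E i j -> 0 <= f i j <= k) ->
  sorted E u -> edge_prod f u <= k ^+ (size u).-1.
Proof.
move=> fk; have f0 i j : E i j -> 0 <= f i j by move=> /fk/andP[].
case: u => // i u; elim: u i => // j u IH i /= /andP[ij ju].
have /andP[h0 hk] := fk _ _ ij.
by rewrite exprS ler_pM ?h0// ?IH//; exact: (edge_prod_ge0 f0 (u := j :: u)).
Qed.

Lemma edge_prod_rev f u :
  edge_prod f (rev u) = edge_prod (fun i j => f j i) u.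
Proof.
case: u => // i u; elim: u i => // j u IH i.
rewrite edge_prod_cons -IH rev_cons -cats1.
have : rev (j :: u) != [::] by rewrite -size_eq0 size_rev.
have : last i (rev (j :: u)) = j by rewrite rev_cons last_rcons.
case: (rev (j :: u)) => // k v <- _.
by rewrite edge_prod_cat mulr1 mulrC.
Qed.

End EdgeProducts.

Section Lifts.
Variable N : nat.

Lemma base_lshift (i : 'I_N) : base (lshift N i) = i.
Proof. by rewrite /base; case: split_ordP => j /eqP; rewrite ?eq_lrshift ?eq_lshift// => /eqP->. Qed.

Lemma base_rshift (i : 'I_N) : base (rshift N i) = i.
Proof. by rewrite /base; case: split_ordP => j /eqP; rewrite ?eq_rlshift ?eq_rshift// => /eqP->. Qed.

Lemma baseE (a : 'I_(N + N)) (i : 'I_N) :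
  (base a == i) = (a == lshift N i) || (a == rshift N i).
Proof.
rewrite /base; case: split_ordP => j ->; first by rewrite eq_lshift eq_lrshift orbF.
by rewrite eq_rshift eq_rlshift.
Qed.

Fixpoint liftseq (u : seq 'I_N) : seq (seq 'I_(N + N)) :=
  if u is i :: u' then
    map (cons (lshift N i)) (liftseq u') ++ map (cons (rshift N i)) (liftseq u')
  else [:: [::]].

Lemma mem_liftseq u w : (w \in liftseq u) = (map (@base N) w == u).
Proof.
elim: u w => [|i u IH] w /=; first by case: w.
have mem_cons (b : 'I_(N + N)) a w' :
    (a :: w' \in map (cons b) (liftseq u)) = (a == b) && (map (@base N) w' == u).
  rewrite -IH; apply/mapP/andP => [[v vu [-> ->]]//|[/eqP-> wu]].
  by exists w'.
rewrite mem_cat; case: w => [|a w].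
  by apply/negbTE/negP => /orP[] /mapP[].
by rewrite !mem_cons -andb_orl -baseE.
Qed.

Lemma uniq_liftseq u : uniq (liftseq u).
Proof.
elim: u => //= i u IH; rewrite cat_uniq !map_inj_uniq ?IH; try by move=> ? ? [].
rewrite andbT; apply/hasPn => _ /mapP[w _ ->]; apply/mapP => -[v _ /eqP].
by rewrite eqseq_cons eq_rlshift.
Qed.

Lemma sum_lift_nil (V : nmodType) (F : seq 'I_(N + N) -> V) :
  \sum_(w <- liftseq [::]) F w = F [::].
Proof. by rewrite big_seq1. Qed.

Lemma sum_lift_cons (V : nmodType) i u (F : seq 'I_(N + N) -> V) :
  \sum_(w <- liftseq (i :: u)) F w =
  \sum_(w <- liftseq u) F (lshift N i :: w) + \sum_(w <- liftseq u) F (rshift N i :: w).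
Proof. by rewrite [liftseq _]/= big_cat !big_map. Qed.

Lemma sum_lift_cat (V : nmodType) u v (F : seq 'I_(N + N) -> V) :
  \sum_(w <- liftseq (u ++ v)) F w =
  \sum_(w <- liftseq u) \sum_(w' <- liftseq v) F (w ++ w').
Proof.
elim: u F => [|i u IH] F; first by rewrite sum_lift_nil.
by rewrite cat_cons !sum_lift_cons !IH.
Qed.

Lemma sum_lift_rev (V : nmodType) u (F : seq 'I_(N + N) -> V) :
  \sum_(w <- liftseq (rev u)) F w = \sum_(w <- liftseq u) F (rev w).
Proof.
elim: u F => [|i u IH] F; first by rewrite !sum_lift_nil.
rewrite rev_cons -cats1 sum_lift_cat IH sum_lift_cons -big_split.
apply: eq_bigr => w _; rewrite sum_lift_cons !sum_lift_nil.
by rewrite !cats1 -!rev_cons.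
Qed.

Lemma sum_lift_words (V : nmodType) n (F : seq 'I_(N + N) -> V) :
  \sum_(u <- words 'I_N n) \sum_(w <- liftseq u) F w =
  \sum_(w <- words 'I_(N + N) n) F w.
Proof.
elim: n F => [|n IH] F; first by rewrite (sum_words0 (fun u => \sum_(w <- liftseq u) F w)) sum_lift_nil.
rewrite (sum_wordsS _ (fun u => \sum_(w <- liftseq u) F w)) sum_wordsS.
rewrite big_split_ord /= -big_split; apply: eq_bigr => i _ /=.
by rewrite -!IH -big_split; apply: eq_bigr => u _; exact: sum_lift_cons.
Qed.

End Lifts.

Section Energy.
Variables (R : realType) (N : nat) (e : rel 'I_(N + N)) (E : rel 'I_N).
Variables (chi : 'I_(N + N) -> R) (P : 'I_(N + N) -> 'I_(N + N) -> R).
Variables (s : 'I_N -> 'I_N -> R) (r : R).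
Hypothesis eE : forall a b, e a b = E (base a) (base b).
Hypothesis chi_gt0 : forall a, 0 < chi a.
Hypothesis chi_sum : \sum_a chi a = 1.
Hypothesis P_ge0 : forall a b, 0 <= P a b.
Hypothesis P_gt0 : forall a b, e a b -> 0 < P a b.
Hypothesis P_sum : forall a, \sum_b P a b = 1.
Hypothesis s_ratio : forall i j, E i j -> 0 < s i j < 1.
Hypothesis r_gt0 : 0 < r.

(* The value 1 on the empty word makes the weights quasi-multiplicative without
any nonemptiness condition. *)
Definition path_weight (w : seq 'I_(N + N)) : R :=
  if w is a :: _ then chi a * edge_prod P w else 1.

(** For admissible [u] this is the [mu]-measure of the cylinder of [u], as [mu_Jset] shows; [energy]
    is the function h of the overview. *)
Definition mass u := \sum_(w <- liftseq u) path_weight w.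

Definition energy u := mass u * edge_prod s u `^ r.

Lemma sorted_lift w : sorted e w = sorted E (map (@base N) w).
Proof. by rewrite sorted_map; apply: eq_sorted => a b; rewrite eE. Qed.

Lemma sorted_liftseq u w : w \in liftseq u -> sorted e w = sorted E u.
Proof. by rewrite mem_liftseq sorted_lift => /eqP->. Qed.

Lemma edge_prod_doubled u w :
  w \in liftseq u -> edge_prod (doubled s) w = edge_prod s u.
Proof.
rewrite mem_liftseq => /eqP<-; elim: w => // a [|b w] IH //.
exact: congr2 IH.
Qed.

Lemma chi_le1 a : chi a <= 1.
Proof.
rewrite -chi_sum (bigD1 a)//= lerDl sumr_ge0// => b _; exact: ltW.
Qed.

Lemma P_le1 a b : P a b <= 1.
Proof. by rewrite -(P_sum a) (bigD1 b)//= lerDl sumr_ge0. Qed.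

Lemma path_weight_gt0 w : sorted e w -> 0 < path_weight w.
Proof.
case: w => [|a w] wE; rewrite ?ltr01// mulr_gt0//.
exact: edge_prod_gt0 wE.
Qed.

Lemma liftseq_neq0 (u : seq 'I_N) : exists w, w \in liftseq u.
Proof.
exists (map (lshift N) u); rewrite mem_liftseq -map_comp.
by apply/eqP; apply: map_id_in => i _ /=; rewrite base_lshift.
Qed.

Lemma mass_ge0 u : sorted E u -> 0 <= mass u.
Proof.
move=> uE; rewrite /mass big_seq sumr_ge0// => w wu.
by rewrite ltW// path_weight_gt0// (sorted_liftseq wu).
Qed.

Lemma mass_gt0 u : sorted E u -> 0 < mass u.
Proof.
move=> uE; have [w wu] := liftseq_neq0 u.
rewrite /mass (big_rem w)//= ltr_wpDr ?path_weight_gt0 ?(sorted_liftseq wu)//.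
rewrite big_seq sumr_ge0// => v /mem_rem vu.
by rewrite ltW// path_weight_gt0// (sorted_liftseq vu).
Qed.

Lemma mass_nil : mass [::] = 1.
Proof. by rewrite /mass sum_lift_nil. Qed.

Lemma mass_cat u v : mass (u ++ v) =
  \sum_(w <- liftseq u) \sum_(w' <- liftseq v) path_weight (w ++ w').
Proof. exact: sum_lift_cat. Qed.

Lemma sum_lift_edge_prod_le1 a u :
  \sum_(w <- liftseq u) edge_prod P (a :: w) <= 1.
Proof.
elim: u a => [|i u IH] a; first by rewrite sum_lift_nil.
rewrite sum_lift_cons -(P_sum a) big_split_ord /=; apply: lerD.
  rewrite -mulr_sumr (bigD1 i)//=; apply: ler_wpDr; first exact: sumr_ge0.
  by rewrite ler_piMr// IH.
rewrite -mulr_sumr (bigD1 i)//=; apply: ler_wpDr; first exact: sumr_ge0.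
by rewrite ler_piMr// IH.
Qed.

Lemma mass_le1 u : mass u <= 1.
Proof.
case: u => [|i u]; first by rewrite mass_nil.
have le_chi a : \sum_(w <- liftseq u) path_weight (a :: w) <= chi a.
  rewrite -[leRHS]mulr1; apply: (@le_trans _ _ (chi a * \sum_(w <- liftseq u) edge_prod P (a :: w))).
    by rewrite mulr_sumr.
  by rewrite ler_wpM2l ?sum_lift_edge_prod_le1// ltW.
rewrite /mass sum_lift_cons -[leRHS]chi_sum big_split_ord /=.
by apply: lerD; apply: le_trans (le_chi _) _; rewrite [leRHS](bigD1 i)//= lerDl sumr_ge0// => j _; exact: ltW.
Qed.

(** Joining two paths replaces the initial factor [chi b] of the second one by a transition
    probability, which is at most 1; the assumption [1 <= k * chi b] pays for the exchange. *)
Lemma path_weight_cat_le k w w' : 1 <= k -> (forall a, 1 <= k * chi a) ->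
  sorted e (w ++ w') -> path_weight (w ++ w') <= k * path_weight w * path_weight w'.
Proof.
move=> k1 kchi ww; have [wE wE'] := sorted_cat_lr ww.
have k0 : 0 <= k by rewrite (le_trans _ k1).
case: w ww wE => [|a w] ww wE.
  by rewrite mulr1 ler_peMl// ltW// path_weight_gt0.
case: w' ww wE' => [|b w'] ww wE'.
  by rewrite cats0 mulr1 ler_peMl// ltW// path_weight_gt0.
have P01 x y : e x y -> 0 <= P x y <= 1 by rewrite P_ge0 P_le1.
have a0 := ltW (chi_gt0 a).
have P0 x y : e x y -> 0 <= P x y by [].
rewrite /path_weight cat_cons -cat_cons.
apply: (@le_trans _ _ (chi a * (edge_prod P (a :: w) * edge_prod P (b :: w')))).
  by rewrite ler_wpM2l// (edge_prod_cat_le P01 ww).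
rewrite [leRHS](_ : _ = (k * chi b) * (chi a * (edge_prod P (a :: w) * edge_prod P (b :: w')))).
  by rewrite ler_peMl// !mulr_ge0// (edge_prod_ge0 P0).
ring.
Qed.

(** The opposite exchange: the joining transition is at least [k], and the lost factor [chi b] is at
    most 1. *)
Lemma path_weight_cat_ge k w w' : 0 <= k <= 1 ->
  (forall a b, e a b -> k <= P a b) ->
  sorted e (w ++ w') -> k * path_weight w * path_weight w' <= path_weight (w ++ w').
Proof.
move=> /andP[k0 k1] kP ww; have [wE wE'] := sorted_cat_lr ww.
case: w ww wE => [|a w] ww wE.
  by rewrite mulr1 ler_piMl// ltW// path_weight_gt0.
case: w' ww wE' => [|b w'] ww wE'.
  by rewrite cats0 mulr1 ler_piMl// ltW// path_weight_gt0.
have a0 := ltW (chi_gt0 a).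
have P0 x y : e x y -> 0 <= P x y by [].
rewrite /path_weight cat_cons -cat_cons.
apply: (@le_trans _ _ (chi a * (k * edge_prod P (a :: w) * edge_prod P (b :: w')))).
  rewrite [leLHS](_ : _ = chi b * (chi a * (k * edge_prod P (a :: w) * edge_prod P (b :: w')))).
    by rewrite ler_piMl ?chi_le1// !mulr_ge0// (edge_prod_ge0 P0).
  ring.
by rewrite ler_wpM2l// (edge_prod_cat_ge _ kP ww)// k0.
Qed.

Lemma energy_gt0 u : sorted E u -> 0 < energy u.
Proof.
move=> uE; rewrite mulr_gt0 ?mass_gt0// powR_gt0// (edge_prod_gt0 _ uE)//.
by move=> i j /s_ratio/andP[].
Qed.

Lemma energy_nil : energy [::] = 1.
Proof. by rewrite /energy mass_nil powR1 mul1r. Qed.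

Lemma edge_prod_s_ge0 u : sorted E u -> 0 <= edge_prod s u.
Proof. by apply: edge_prod_ge0 => i j /s_ratio/andP[/ltW]. Qed.

Lemma energy_cat_le : exists2 C, 0 < C &
  forall u v, sorted E (u ++ v) -> energy (u ++ v) <= C * energy u * energy v.
Proof.
have [d d0 dchi] : exists2 d, 0 < d & forall a, d <= chi a.
  apply: finite_uniform_pos => [x e' d' /andP[_ /le_trans]|a]; first exact.
  by exists (chi a).
pose k := Order.max 1 d^-1.
have k1 : 1 <= k by rewrite le_max lexx.
have k0 : 0 < k by rewrite (lt_le_trans _ k1).
have kchi a : 1 <= k * chi a.
  by rewrite -(mulVf (lt0r_neq0 d0)) ler_pM ?invr_ge0 ?(ltW d0)// le_max lexx orbT.
exists k => // u v uv; have [uE vE] := sorted_cat_lr uv.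
rewrite /energy [leRHS](_ : _ = (k * mass u * mass v) * (edge_prod s u `^ r * edge_prod s v `^ r)); last by ring.
apply: ler_pM; rewrite ?powR_ge0 ?mass_ge0//.
  (* The double sums over pairs of lifts are compared term by term, because any lift of [u] followed
     by any lift of [v] is admissible. *)
  rewrite mass_cat -mulrA {1}/mass mulr_suml mulr_sumr.
  rewrite big_seq [leRHS]big_seq; apply: ler_sum => w wu.
  rewrite /mass !mulr_sumr; rewrite big_seq [leRHS]big_seq; apply: ler_sum => w' wv.
  rewrite mulrA; apply: path_weight_cat_le => //.
  rewrite sorted_lift map_cat; move: wu wv; rewrite !mem_liftseq => /eqP-> /eqP-> //.
rewrite -powRM ?edge_prod_s_ge0// ge0_ler_powR ?nnegrE ?mulr_ge0 ?edge_prod_s_ge0// ?(ltW r_gt0)//.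
by apply: (edge_prod_cat_le _ uv) => i j /s_ratio/andP[? ?]; rewrite !ltW.
Qed.

Lemma energy_cat_ge : exists2 c, 0 < c &
  forall u v, sorted E (u ++ v) -> c * energy u * energy v <= energy (u ++ v).
Proof.
have [d d0 dP] : exists2 d, 0 < d & forall ab : _ * _, e ab.1 ab.2 -> d <= P ab.1 ab.2.
  apply: finite_uniform_pos => [x d d' /andP[_ /le_trans] dd + xE|[a b]].
    by move=> /(_ xE)/dd.
  have [/P_gt0 p0|] := boolP (e a b); first by exists (P a b).
  by exists 1.
have [t t0 tS] : exists2 d, 0 < d & forall ab : _ * _, E ab.1 ab.2 -> d <= s ab.1 ab.2.
  apply: finite_uniform_pos => [x t t' /andP[_ /le_trans] dd + xE|[a b]].
    by move=> /(_ xE)/dd.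
  have [/s_ratio/andP[p0 _]|] := boolP (E a b); first by exists (s a b).
  by exists 1.
pose k := Order.min 1 d; pose l := Order.min 1 t.
have k0 : 0 < k by rewrite lt_min ltr01.
have l0 : 0 < l by rewrite lt_min ltr01.
have k01 : 0 <= k <= 1 by rewrite (ltW k0) ge_min lexx.
have l01 : 0 <= l <= 1 by rewrite (ltW l0) ge_min lexx.
have kP a b : e a b -> k <= P a b.
  by move=> ab; rewrite (le_trans _ (dP (a, b) ab))// ge_min lexx orbT.
have lS i j : E i j -> l <= s i j.
  by move=> ab; rewrite (le_trans _ (tS (i, j) ab))// ge_min lexx orbT.
exists (k * l `^ r); first by rewrite mulr_gt0// powR_gt0.
move=> u v uv; have [uE vE] := sorted_cat_lr uv.
rewrite /energy [leLHS](_ : _ = (k * mass u * mass v) * (l `^ r * edge_prod s u `^ r * edge_prod s v `^ r)); last by ring.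
apply: ler_pM; rewrite ?mulr_ge0 ?powR_ge0 ?mass_ge0 ?(ltW k0)//.
  rewrite mass_cat -mulrA {1}/mass mulr_suml mulr_sumr.
  rewrite big_seq [leRHS]big_seq; apply: ler_sum => w wu.
  rewrite /mass !mulr_sumr; rewrite big_seq [leRHS]big_seq; apply: ler_sum => w' wv.
  rewrite mulrA; apply: path_weight_cat_ge => //.
  rewrite sorted_lift map_cat; move: wu wv; rewrite !mem_liftseq => /eqP-> /eqP-> //.
rewrite -!powRM ?mulr_ge0 ?(ltW l0) ?edge_prod_s_ge0// ge0_ler_powR ?nnegrE ?mulr_ge0 ?(ltW l0) ?edge_prod_s_ge0// ?(ltW r_gt0)//.
exact: edge_prod_cat_ge uv.
Qed.

Lemma energy_le_expr : exists2 q, 0 < q < 1 &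
  forall u, sorted E u -> energy u <= q ^+ (size u).-1.
Proof.
have [t t0 tS] : exists2 d, 0 < d & forall ij : _ * _, E ij.1 ij.2 -> s ij.1 ij.2 <= 1 - d.
  apply: finite_uniform_pos => [x t t' /andP[_ tt] + xE|[i j]].
    by move=> /(_ xE)/le_trans; apply; rewrite lerB.
  have [/s_ratio/andP[p0 p1]|] := boolP (E i j); last by exists 1.
  by exists (1 - s i j); rewrite ?subr_gt0// => _; rewrite subKr.
(* [1 - t] need not be positive; the maximum with 1/2 keeps [k] strictly between 0 and 1. *)
pose k := Order.max 2^-1 (1 - t).
have k0 : 0 < k by rewrite lt_max invr_gt0 ltr0n.
have k1 : k < 1 by rewrite gt_max invf_lt1 ?ltr1n ?ltr0n//= gtrBl.
have q0 : 0 < k `^ r by rewrite powR_gt0.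
have q1 : k `^ r < 1.
  by have := @gt0_ltr_powR R r r_gt0 k 1; rewrite powR1 !nnegrE; apply => //; exact: ltW.
exists (k `^ r) => [|u uE]; first by rewrite q0.
rewrite /energy -[leRHS]mul1r ler_pM ?powR_ge0 ?mass_ge0 ?mass_le1//.
rewrite -powR_mulrn ?(ltW q0)// -powRrM mulrC powRrM powR_mulrn ?(ltW k0)//.
rewrite ge0_ler_powR ?nnegrE ?edge_prod_s_ge0 ?exprn_ge0 ?(ltW k0) ?(ltW r_gt0)//.
apply: edge_prod_le_expr uE => i j ij; have /andP[/ltW -> _] := s_ratio ij.
by rewrite le_max (tS (i, j) ij) orbT.
Qed.

Lemma energy_small eta : 0 < eta ->
  exists L, forall u, sorted E u -> size u = L -> energy u < eta.
Proof.
have [q /andP[q0 q1] qE] := energy_le_expr => eta0.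
have := @cvg_expr R q; rewrite ger0_norm ?(ltW q0)// => /(_ q1).
move=> /cvgrPdist_lt/(_ _ eta0)[L _ HL]; exists L.+1 => u uE uL.
apply: le_lt_trans (qE _ uE) _; rewrite uL /=.
have := HL L (leqnn L); rewrite /= sub0r normrN ger0_norm// exprn_ge0// ltW//.
Qed.

End Energy.

(** * Geometry of the cylinders *)

Section EuclideanNorm.
Variables (R : realType) (q : nat).
Implicit Types x y : 'rV[R]_q.

Lemma enorm_ge0 x : 0 <= enorm x. Proof. exact: sqrtr_ge0. Qed.

Lemma enorm_sym x y : enorm (x - y) = enorm (y - x).
Proof.
by rewrite /enorm; congr Num.sqrt; apply: eq_bigr => i _; rewrite !mxE -sqrrN opprB.
Qed.

Lemma norm_le_enorm x : `|x| <= enorm x.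
Proof.
rewrite [leLHS]/Num.norm /= mx_normrE; apply/bigmax_leP; split=> [|[i j] _ /=].
  exact: enorm_ge0.
rewrite ord1 -sqrtr_sqr ler_sqrt; last by apply: sumr_ge0 => k _; exact: sqr_ge0.
by rewrite (bigD1 j)//= lerDl; apply: sumr_ge0 => k _; exact: sqr_ge0.
Qed.

Lemma enorm_le_norm x : enorm x <= Num.sqrt q%:R * `|x|.
Proof.
have h j : `|x ord0 j| <= `|x|.
  by rewrite [leRHS]/Num.norm /= mx_normrE; apply/bigmax_geP; right; exists (ord0, j).
rewrite -[leRHS]ger0_norm ?mulr_ge0 ?sqrtr_ge0// -[leRHS]sqrtr_sqr ler_sqrt ?sqr_ge0//.
rewrite exprMn sqr_sqrtr// -[q in q%:R]card_ord -sum1_card natr_sum mulr_suml.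
by apply: ler_sum => i _; rewrite mul1r -real_normK ?num_real// lerXn2r ?nnegrE.
Qed.

Lemma enorm0 : enorm (0 : 'rV[R]_q) = 0.
Proof.
apply/eqP; rewrite eq_le enorm_ge0 andbT; apply: le_trans (enorm_le_norm _) _.
by rewrite normr0 mulr0.
Qed.

Lemma enorm_eq0 x : enorm x = 0 -> x = 0.
Proof. by move=> x0; apply/eqP; rewrite -normr_le0 -x0 norm_le_enorm. Qed.

Lemma enorm_continuous : continuous (@enorm R q).
Proof.
have sum_cont : continuous (fun x : 'rV[R]_q => \sum_i x ord0 i ^+ 2).
  apply: continuous_big => [|i _ x]; first exact: add_continuous.
  apply: (@continuous_comp _ _ _ (fun x : 'rV[R]_q => x ord0 i) (fun t : R => t ^+ 2)).
    exact: coord_continuous.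
  exact: exprn_continuous.
move=> x; apply: (continuous_comp (sum_cont x)); exact: sqrt_continuous.
Qed.

Lemma compact_dist_gt0 (A B : set 'rV[R]_q) : compact A -> compact B ->
  A `&` B = set0 ->
  exists2 d, 0 < d & forall x y, A x -> B y -> d <= enorm (x - y).
Proof.
move=> cA cB AB.
have [AB0|/nonemptyPn AB0] := pselect ((A `*` B) !=set0); last first.
  exists 1 => // x y Ax By; have : set0 (x, y) by rewrite -AB0.
  by [].
have f_cont : continuous (fun p : 'rV[R]_q * 'rV[R]_q => enorm (p.1 - p.2)).
  move=> p; apply: (@continuous_comp _ _ _ (fun p : 'rV[R]_q * 'rV[R]_q => p.1 - p.2)).
    by apply: cvgB; [exact: cvg_fst | exact: cvg_snd].
  exact: enorm_continuous.
have [p /set_mem[Ap Bp] pmin] := compact_EVT_min AB0 (compact_setX cA cB)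
  (continuous_subspaceT f_cont).
exists (enorm (p.1 - p.2)) => [|x y Ax By]; last first.
  by apply: (pmin (x, y)); exact: mem_set.
rewrite lt_neqAle enorm_ge0 andbT eq_sym; apply/eqP => /enorm_eq0/eqP.
rewrite subr_eq0 => /eqP pp; have : set0 p.1 by rewrite -AB; split => //; rewrite pp.
by [].
Qed.

Lemma compact_diam (A : set 'rV[R]_q) : compact A ->
  exists2 D, 0 < D & forall x y, A x -> A y -> enorm (x - y) <= D.
Proof.
move=> /compact_bounded[M [_ HM]].
have {}HM x : A x -> `|x| <= `|M| + 1.
  by apply: HM; rewrite (le_lt_trans (ler_norm M))// ltrDl.
have M0 : 0 < `|M| + 1 by rewrite ltr_wpDl.
exists ((Num.sqrt q%:R + 1) * (2 * (`|M| + 1))) => [|x y Ax Ay].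
  by rewrite !mulr_gt0// ltr_wpDl// sqrtr_ge0.
apply: le_trans (enorm_le_norm _) _; apply: ler_pM; rewrite ?sqrtr_ge0 ?lerDl//.
by apply: le_trans (ler_normB _ _) _; rewrite mulr_natl mulr2n lerD// HM.
Qed.

Lemma similarity_continuous (k : R) (f : 'rV[R]_q -> 'rV[R]_q) :
  0 < k -> similarity k f -> continuous f.
Proof.
move=> k0 fk x A /nbhs_ballP[ep /= ep0]; rewrite -ball_normE => xA.
have m0 : 0 < k * (Num.sqrt q%:R + 1) by rewrite mulr_gt0// ltr_wpDl// sqrtr_ge0.
apply/nbhs_ballP; exists ((k * (Num.sqrt q%:R + 1))^-1 * ep) => /=.
  by rewrite mulr_gt0// invr_gt0.
move=> y; rewrite -ball_normE /= ltr_pdivlMl// => xy; apply: xA => /=.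
apply: le_lt_trans (norm_le_enorm _) _; rewrite fk.
apply: le_lt_trans (ler_wpM2l (ltW k0) (enorm_le_norm _)) _.
by apply: le_lt_trans xy; rewrite -mulrA ler_wpM2l ?(ltW k0)// ler_wpM2r// lerDl.
Qed.

End EuclideanNorm.

Section Cylinders.
Variables (R : realType) (q N : nat) (E : rel 'I_N) (J : 'I_N -> set 'rV[R]_q).
Variables (T : 'I_N -> 'I_N -> 'rV[R]_q -> 'rV[R]_q) (s : 'I_N -> 'I_N -> R).
Hypothesis J_nonempty : forall i, J i !=set0.
Hypothesis J_disjoint : trivIset setT J.
Hypothesis J_compact : forall i, compact (J i).
Hypothesis s_ratio : forall i j, E i j -> 0 < s i j < 1.
Hypothesis T_similarity : forall i j, E i j -> similarity (s i j) (T i j).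
Hypothesis T_sub : forall i j, E i j -> T i j @` J j `<=` J i.
Hypothesis T_disjoint : trivIset [set ij : 'I_N * 'I_N | E ij.1 ij.2]
  (fun ij => T ij.1 ij.2 @` J ij.2).
Implicit Types u v : seq 'I_N.

(* The empty word stands for the whole space, the root of the tree of cylinders. *)
Definition Jset u : set 'rV[R]_q :=
  if u is i :: v then edge_comp T u @` J (last i v) else setT.

Lemma Jset_cons i j u : Jset (i :: j :: u) = T i j @` Jset (j :: u).
Proof. by rewrite /Jset image_comp. Qed.

Lemma Jset1 i : Jset [:: i] = J i.
Proof. by rewrite /Jset /= image_id. Qed.

Lemma Jset_sub_head i u : sorted E (i :: u) -> Jset (i :: u) `<=` J i.
Proof.
elim: u i => [|j u IH] i; first by move=> _; rewrite Jset1; exact: subset_refl.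
rewrite [sorted _ _]/= => /andP[ij ju]; rewrite Jset_cons.
by apply: subset_trans (T_sub ij); apply: image_subset; exact: IH.
Qed.

Lemma Jset_rcons_sub u j : sorted E (rcons u j) -> Jset (rcons u j) `<=` Jset u.
Proof.
case: u => // i u; elim: u i => [|k u IH] i.
  by move=> ij; rewrite Jset1; exact: Jset_sub_head.
rewrite [sorted _ _]/= => /andP[ik ku]; rewrite !rcons_cons !Jset_cons.
by apply: image_subset; exact: IH.
Qed.

Lemma Jset_compact u : u != [::] -> sorted E u -> compact (Jset u).
Proof.
case: u => // i u _; elim: u i => [|j u IH] i; first by rewrite Jset1.
rewrite [sorted _ _]/= => /andP[ij ju]; rewrite Jset_cons.
apply: continuous_compact; last exact: IH.
apply: continuous_subspaceT; apply: similarity_continuous (T_similarity ij).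
by case/andP: (s_ratio ij).
Qed.

Lemma Jset_nonempty u : Jset u !=set0.
Proof.
case: u => [|i u]; first by exists 0.
by have [x Jx] := J_nonempty (last i u); exists (edge_comp T (i :: u) x), x.
Qed.

Lemma Jset_diam : exists2 D, 0 < D & forall u x y, u != [::] -> sorted E u ->
  Jset u x -> Jset u y -> enorm (x - y) <= D * edge_prod s u.
Proof.
(* The diameters are bounded by an inverse, because [finite_uniform_pos] asks for a property
   preserved when [d] shrinks. *)
have [d d0 dJ] : exists2 d, 0 < d & forall i x y, J i x -> J i y -> enorm (x - y) <= d^-1.
  apply: finite_uniform_pos => [i d d' /andP[d'0 dd] + x y xJ yJ|i].
    move=> /(_ x y xJ yJ)/le_trans; apply; rewrite lef_pV2 ?posrE//.
    exact: lt_le_trans dd.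
  have [D D0 DJ] := compact_diam (@J_compact i); exists D^-1; rewrite ?invr_gt0// invrK.
  exact: DJ.
exists d^-1; first by rewrite invr_gt0.
case=> // i u + + _; elim: u i => [|j u IH] i x y.
  by move=> _; rewrite Jset1 mulr1; exact: dJ.
rewrite [sorted _ _]/= => /andP[ij ju]; rewrite Jset_cons edge_prod_cons.
move=> [x' xJ <-] [y' yJ <-]; rewrite (T_similarity ij) mulrCA ler_wpM2l ?IH//.
by case/andP: (s_ratio ij) => /ltW.
Qed.

Lemma edge_prod_s_le1 u : sorted E u -> edge_prod s u <= 1.
Proof.
move=> uE; rewrite -(expr1n R (size u).-1); apply: edge_prod_le_expr uE => i j.
by move=> /s_ratio/andP[/ltW -> /ltW ->].
Qed.

Lemma Jset_separated : exists2 d, 0 < d & forall u v x y,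
  incomparable u v -> sorted E u -> sorted E v -> Jset u x -> Jset v y ->
  d * edge_prod s u <= enorm (x - y).
Proof.
have [d d0 dJ] : exists2 d, 0 < d & forall ij : _ * _, ij.1 != ij.2 ->
    forall x y, J ij.1 x -> J ij.2 y -> d <= enorm (x - y).
  apply: finite_uniform_pos => [ij d d' /andP[_ /le_trans dd] + n x y Jx Jy|[i j] /=].
    by move=> /(_ n x y Jx Jy); exact: dd.
  have [<-|ij] := eqVneq i j; first by exists 1; rewrite // eqxx.
  have /trivIsetP/(_ i j I I ij) JJ := J_disjoint.
  by have [d d0 dJ] := compact_dist_gt0 (@J_compact i) (@J_compact j) JJ; exists d.
have [d' d'0 dT] : exists2 d, 0 < d & forall ijk : 'I_N * 'I_N * 'I_N,
    ijk.1.2 != ijk.2 -> E ijk.1.1 ijk.1.2 -> E ijk.1.1 ijk.2 ->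
    forall x y, (T ijk.1.1 ijk.1.2 @` J ijk.1.2) x ->
    (T ijk.1.1 ijk.2 @` J ijk.2) y -> d <= enorm (x - y).
  apply: finite_uniform_pos => [ij t t' /andP[_ /le_trans dd] + n e1 e2 x y Jx Jy|[[i j] k] /=].
    by move=> /(_ n e1 e2 x y Jx Jy); exact: dd.
  have [<-|jk] := eqVneq j k; first by exists 1; rewrite // eqxx.
  have [ij|] := boolP (E i j); last by exists 1.
  have [ik|] := boolP (E i k); last by exists 1.
  have cT l : E i l -> compact (T i l @` J l).
    move=> il; rewrite -Jset1 -Jset_cons; apply: Jset_compact => //=.
    by rewrite il.
  have n : (i, j) != (i, k) by rewrite xpair_eqE eqxx.
  have /trivIsetP/(_ (i, j) (i, k) ij ik n) TT := T_disjoint.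
  by have [t t0 tJ] := compact_dist_gt0 (cT j ij) (cT k ik) TT; exists t.
pose m := Order.min d d'.
have m0 : 0 < m by rewrite lt_min d0.
exists m => //.
case=> [|i u] [|j v] x y //; rewrite /incomparable ?prefix0s//.
elim: u i j v x y => [|k u IH] i j v x y.
  rewrite prefix_cons prefix0s andbT => /andP[ij _] _ jv.
  rewrite Jset1 mulr1 => Jx /(Jset_sub_head jv) Jy.
  by apply: le_trans (dJ (i, j) ij _ _ Jx Jy); rewrite ge_min lexx.
have [<-{j}|ij] := eqVneq i j; last first.
  move=> _ uE vE /(Jset_sub_head uE) Jx /(Jset_sub_head vE) Jy.
  apply: le_trans (dJ (i, j) ij _ _ Jx Jy); rewrite -[leRHS]mulr1.
  apply: ler_pM; rewrite ?edge_prod_s_le1 ?(ltW m0) ?ge_min ?lexx//.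
  by rewrite (edge_prod_ge0 _ uE)// => ? ? /s_ratio/andP[/ltW].
rewrite !prefix_cons eqxx !andTb.
case: v => [|l v]; first by rewrite prefix0s andbF.
move=> kl; rewrite ![sorted _ (i :: _)]/= => /andP[ik ku] /andP[il lv].
rewrite !Jset_cons => Jx Jy.
have [lk|nkl] := eqVneq l k.
  move: kl lv Jy; rewrite lk => kl lv [y' Jy <-]; case: Jx => [x' Jx <-].
  rewrite (T_similarity ik) edge_prod_cons mulrCA ler_wpM2l//.
    by case/andP: (s_ratio ik) => /ltW.
  exact: IH kl ku lv Jx Jy.
have Jx' : (T i k @` J k) x by apply: image_subset Jx; exact: Jset_sub_head.
have Jy' : (T i l @` J l) y by apply: image_subset Jy; exact: Jset_sub_head.
have nkl' : k != l by rewrite eq_sym.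
apply: le_trans (dT (i, k, l) nkl' ik il _ _ Jx' Jy'); rewrite -[leRHS]mulr1.
have uE : sorted E (i :: k :: u) by rewrite /= ik.
apply: ler_pM; rewrite ?edge_prod_s_le1 ?(ltW m0) ?ge_min ?lexx ?orbT//.
by rewrite (edge_prod_ge0 _ uE)// => ? ? /s_ratio/andP[/ltW].
Qed.

Lemma Jset_disjoint u v : incomparable u v -> sorted E u -> sorted E v ->
  Jset u `&` Jset v = set0.
Proof.
have [d d0 dsep] := Jset_separated => uv uE vE.
apply/seteqP; split => // x [/= ux vx].
have := dsep _ _ _ _ uv uE vE ux vx; rewrite subrr enorm0 leNgt mulr_gt0//.
by rewrite (edge_prod_gt0 _ uE)// => i j /s_ratio/andP[].
Qed.

End Cylinders.

(** * The measure of the cylinders *)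

Lemma measure_fibers (d : measure_display) (X : measurableType d) (R : realType)
    (nu : {measure set X -> \bar R}) (W : eqType) (f : X -> W) (ws : seq W) :
  (forall w, measurable [set x | f x = w]) -> uniq ws ->
  measurable [set x | f x \in ws] /\
  nu [set x | f x \in ws] = (\sum_(w <- ws) nu [set x | f x = w])%E.
Proof.
move=> mf; elim: ws => [|w ws IH] /=.
  have -> : [set x | f x \in [::]] = set0 by apply/seteqP; split.
  by rewrite measure0 big_nil.
move=> /andP[wws /IH[mws nuE]].
have -> : [set x | f x \in w :: ws] = [set x | f x = w] `|` [set x | f x \in ws].
  apply/seteqP; split => x /=; rewrite inE.
    by move=> /orP[/eqP|]; [left|right].
  by case=> [/eqP ->|->]; rewrite ?orbT.
split; first exact: measurableU.
rewrite measureU//; first by rewrite big_cons; exact: congr2 nuE.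
by apply/seteqP; split => // x /= [-> wws']; rewrite wws' in wws.
Qed.

Section Coding.
Variables (R : realType) (q N : nat) (N_gt1 : (1 < N)%N).
Variables (e : rel 'I_(N + N)) (e_out : forall a, exists b, e a b).
Variables (E : rel 'I_N) (J : 'I_N -> set 'rV[R]_q).
Variables (T : 'I_N -> 'I_N -> 'rV[R]_q -> 'rV[R]_q) (s : 'I_N -> 'I_N -> R).
Hypothesis eE : forall a b, e a b = E (base a) (base b).
Hypothesis J_nonempty : forall i, J i !=set0.
Hypothesis J_disjoint : trivIset setT J.
Hypothesis J_compact : forall i, compact (J i).
Hypothesis s_ratio : forall i j, E i j -> 0 < s i j < 1.
Hypothesis T_similarity : forall i j, E i j -> similarity (s i j) (T i j).
Hypothesis T_sub : forall i j, E i j -> T i j @` J j `<=` J i.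
Hypothesis T_disjoint : trivIset [set ij : 'I_N * 'I_N | E ij.1 ij.2]
  (fun ij => T ij.1 ij.2 @` J ij.2).
Variables (chi : 'I_(N + N) -> R) (P : 'M[R]_(N + N)).
Let X := borel (Ginf N_gt1 e_out).

Definition path_prefix n (x : Ginf N_gt1 e_out) : seq 'I_(N + N) :=
  [seq (val x : nat -> 'I_(N + N)) h | h <- iota 0 n].

Lemma path_prefixE n x : path_prefix n x = prefix_word n x :> seq _.
Proof.
by rewrite /prefix_word /= /path_prefix -val_enum_ord -map_comp.
Qed.

Lemma path_prefixS n x : path_prefix n.+1 x =
  rcons (path_prefix n x) ((val x : nat -> 'I_(N + N)) n).
Proof. by rewrite /path_prefix -addn1 iotaD map_cat cats1. Qed.

Lemma size_path_prefix n x : size (path_prefix n x) = n.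
Proof. by rewrite size_map size_iota. Qed.

Lemma path_prefix_sorted n x : sorted e (path_prefix n x).
Proof.
rewrite /path_prefix; case: n => // n; elim: n 0%N => //= n IH m.
by apply/andP; split; [exact: (set_valP x) | exact: IH].
Qed.

Lemma path_prefix_measurable n w : measurable ([set x | path_prefix n x = w] : set X).
Proof.
elim/last_ind: w n => [|w a IH] [|n].
- rewrite [X in measurable X](_ : _ = setT); first exact: measurableT.
  by apply/seteqP; split.
- rewrite [X in measurable X](_ : _ = set0); first exact: measurable0.
  by apply/seteqP; split.
- rewrite [X in measurable X](_ : _ = set0); first exact: measurable0.
  by apply/seteqP; split => // x /= /(congr1 size); rewrite size_rcons.
rewrite [X in measurable X](_ : _ = [set x | path_prefix n x = w] `&`
    [set x | (val x : nat -> 'I_(N + N)) n = a]); last first.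
  apply/seteqP; split=> x /=; rewrite path_prefixS; first by move=> /rcons_inj[].
  by case=> -> xa; congr (rcons _ _).
apply: measurableI; first exact: IH.
apply: sub_sigma_algebra.
have c1 : continuous (fun x : Ginf N_gt1 e_out =>
    (val x : prod_topology (fun _ : nat => discrete_topology 'I_(N + N)))).
  exact: initial_continuous.
have c2 := @proj_continuous nat (fun _ : nat => discrete_topology 'I_(N + N)) n.
have o : open ([set a] : set (discrete_topology 'I_(N + N))) by exact: discrete_open.
have := (continuousP _).1 (fun x => continuous_comp (c1 x) (c2 _)) _ o.
by [].
Qed.

Definition coded_prefix n x := map (@base N) (path_prefix n x).

Lemma coded_prefixS n x : coded_prefix n.+1 x =
  rcons (coded_prefix n x) (base ((val x : nat -> 'I_(N + N)) n)).
Proof. by rewrite /coded_prefix path_prefixS map_rcons. Qed.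

Lemma coded_prefix_sorted n x : sorted E (coded_prefix n x).
Proof. by rewrite -(sorted_lift eE) path_prefix_sorted. Qed.

Lemma size_coded_prefix n x : size (coded_prefix n x) = n.
Proof. by rewrite size_map size_path_prefix. Qed.

Lemma cylinder_setE n x :
  cylinder_set (doubled T) (J \o @base N) (prefix_word n.+1 x) =
  Jset J T (coded_prefix n.+1 x).
Proof.
rewrite /cylinder_set /coded_prefix path_prefixE.
have -> : edge_comp (doubled T) (prefix_word n.+1 x) =
    edge_comp T (map (@base N) (prefix_word n.+1 x)).
  elim: (tval _) => // a [|b w] IH //; exact: congr2 IH.
rewrite (tnth_nth (lshift N (Ordinal (ltnW N_gt1)))).
have := size_tuple (prefix_word n.+1 x); case: (tval _) => // a w [sw].
by rewrite /Jset [map _ _]/= /= last_map -sw -last_nth.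
Qed.

(** The cylinders along a path are nested, nonempty and compact, so their intersection is inhabited
    and [get] does select one of its points. *)
Lemma coding_mem n x : Jset J T (coded_prefix n x) (coding T J x).
Proof.
case: n => // n.
suff : (\bigcap_n cylinder_set (doubled T) (J \o @base N) (prefix_word n.+1 x))
    (coding T J x) by move=> /(_ n I); rewrite cylinder_setE.
apply: getPex.
have Jc k : compact (Jset J T (coded_prefix k.+1 x)).
  apply: (Jset_compact J_compact s_ratio T_similarity).
    by rewrite -size_eq0 size_coded_prefix.
  exact: coded_prefix_sorted.
have Jsub m k : (m <= k)%N ->
    Jset J T (coded_prefix k.+1 x) `<=` Jset J T (coded_prefix m.+1 x).
  move=> /subnK <-; elim: (k - m)%N => [//|l IH].
  apply: subset_trans IH; rewrite coded_prefixS.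
  by apply: (Jset_rcons_sub T_sub); rewrite -coded_prefixS coded_prefix_sorted.
have := Jc 0%N; rewrite compact_In0 => /(_ nat setT
  (fun n => cylinder_set (doubled T) (J \o @base N) (prefix_word n.+1 x))); apply.
  exists (fun n => Jset J T (coded_prefix n.+1 x)) => k _.
    by apply: compact_closed (Jc k); exact: norm_hausdorff.
  by rewrite cylinder_setE setIidr//; exact: Jsub.
(* Finite intersection property: for a finite set [D] of levels, any point of the deepest cylinder
   will do. *)
move=> D _; have [y Jy] := Jset_nonempty T J_nonempty
  (coded_prefix (\max_(i <- finmap.enum_fset D) i).+1 x).
exists y => i /= iD; rewrite cylinder_setE; apply: Jsub Jy.
by apply: leq_bigmax_seq.
Qed.

(** If the coded prefix of [x] differed from [u], the point [coding T J x] would lie in two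
    cylinders of the same level, which are disjoint. *)
Lemma coding_preimage u : sorted E u ->
  coding T J @^-1` Jset J T u =
    [set x : Ginf N_gt1 e_out | path_prefix (size u) x \in liftseq u].
Proof.
move=> uE; apply/seteqP; split => x /=; rewrite mem_liftseq; last first.
  by move=> /eqP <-; exact: coding_mem.
move=> ux; rewrite -/(coded_prefix _ x); apply: contraT => nu.
have inc : incomparable u (coded_prefix (size u) x).
  by apply: incomparable_same_size; rewrite ?size_coded_prefix// eq_sym.
have : set0 (coding T J x).
  rewrite -(Jset_disjoint J_disjoint J_compact s_ratio T_similarity T_sub T_disjoint
    inc uE (coded_prefix_sorted _ _)).
  by split => //; exact: coding_mem.
by [].
Qed.

Variable nu : probability (borel (Ginf N_gt1 e_out)) R.
Hypothesis nu_cyl : forall n (w : n.+1.-tuple 'I_(N + N)), w \in Gwords e n.+1 ->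
  nu [set x | prefix_word n.+1 x = w] = (chi (thead w) * edge_prod P w)%:E.
Variable mu : probability (borel 'rV[R]_q) R.
Hypothesis mu_image : forall A : set (borel 'rV[R]_q), measurable A ->
  mu A = nu (coding T J @^-1` A).

Lemma Jset_measurable u : sorted E u -> measurable (Jset J T u : set (borel 'rV[R]_q)).
Proof.
case: u => [|i u] uE; first exact: measurableT.
have cJ : closed (Jset J T (i :: u)).
  apply: compact_closed; first exact: norm_hausdorff.
  exact: (Jset_compact J_compact s_ratio T_similarity).
rewrite -[Jset _ _ _]setCK; apply: measurableC; apply: sub_sigma_algebra.
exact: closed_openC.
Qed.

Lemma nu_path_prefix w : sorted e w ->
  nu [set x | path_prefix (size w) x = w] = (path_weight chi P w)%:E.
Proof.
case: w => [|a w] wE.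
  rewrite /= [X in nu X](_ : _ = setT); first exact: probability_setT.
  by apply/seteqP; split.
pose t : (size w).+1.-tuple 'I_(N + N) := in_tuple (a :: w).
have tG : t \in Gwords e (size w).+1 by rewrite inE.
rewrite (_ : [set x | _] = [set x | prefix_word (size w).+1 x = t]).
  by rewrite nu_cyl// /thead (tnth_nth a).
apply/seteqP; split => x /=; rewrite path_prefixE; first by move=> h; exact: val_inj.
by move=> ->.
Qed.

Lemma mu_Jset u : sorted E u -> mu (Jset J T u) = (mass chi P u)%:E.
Proof.
move=> uE; rewrite mu_image; last exact: Jset_measurable.
rewrite coding_preimage//.
have [_ ->] := measure_fibers nu (path_prefix_measurable (size u)) (uniq_liftseq u).
rewrite /mass -sumEFin big_seq [RHS]big_seq; apply: eq_bigr => w wu.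
rewrite -nu_path_prefix ?(sorted_liftseq eE wu)//.
by move: wu; rewrite mem_liftseq => /eqP <-; rewrite size_map.
Qed.

(** The children need not fill the cylinder of [u], but what they leave out is [mu]-null: every path
    coded into the cylinder continues into one of the children. *)
Lemma integral_Jset (f : borel 'rV[R]_q -> \bar R) (u : seq 'I_N) :
  measurable_fun (setT : set (borel 'rV[R]_q)) f -> (forall x, 0 <= f x)%E -> sorted E u ->
  (\int[mu]_(x in Jset J T u) f x =
   \sum_(j | sorted E (rcons u j)) \int[mu]_(x in Jset J T (rcons u j)) f x)%E.
Proof.
move=> mf f0 uE.
pose F j : set (borel 'rV[R]_q) :=
  if sorted E (rcons u j) then Jset J T (rcons u j) else set0.
pose js := [seq j <- enum 'I_N | sorted E (rcons u j)].
pose B := \big[setU/set0]_(j <- js) F j.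
have mF j : measurable (F j).
  by rewrite /F; case: ifP => [/Jset_measurable//|_]; exact: measurable0.
have mB : measurable B by exact: bigsetU_measurable.
have mu_ := Jset_measurable uE.
have Bsub : B `<=` Jset J T u.
  rewrite /B big_seq; elim/big_ind: _ => [x []|A1 A2 h1 h2 x [/h1|/h2]|] //.
  move=> j; rewrite mem_filter => /andP[uj _]; rewrite /F uj.
  exact: (Jset_rcons_sub T_sub).
have N0 : mu (Jset J T u `\` B) = 0%E.
  rewrite mu_image; last exact: measurableD.
  rewrite (_ : _ @^-1` _ = set0) ?measure0//.
  apply/seteqP; split => // x [/= xJ]; apply.
  have : (coding T J @^-1` Jset J T u) x by [].
  rewrite coding_preimage//= mem_liftseq -/(coded_prefix _ x) => /eqP xu.
  have xr : rcons u (base ((val x : nat -> 'I_(N + N)) (size u))) =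
      coded_prefix (size u).+1 x by rewrite coded_prefixS xu.
  rewrite /B -bigcup_seq; exists (base ((val x : nat -> 'I_(N + N)) (size u))).
    by rewrite /= mem_filter mem_enum andbT xr coded_prefix_sorted.
  by rewrite /F xr coded_prefix_sorted; exact: coding_mem.
rewrite (ge0_negligible_integral (measurableD mu_ mB) mu_ _ _ N0)//; last first.
  exact: measurable_funTS.
rewrite setDD (setIidr Bsub) ge0_integral_bigsetU//.
- rewrite big_filter big_enum_cond /=; apply: eq_big => [j|j]; first by [].
  by move=> uj; rewrite /F uj.
- by rewrite filter_uniq// enum_uniq.
- apply/trivIsetP => i j /=; rewrite !mem_filter => /andP[ui _] /andP[uj _] ij.
  rewrite /F ui uj; apply: (Jset_disjoint J_disjoint J_compact s_ratio T_similarity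
    T_sub T_disjoint _ ui uj).
  apply: incomparable_same_size; rewrite ?size_rcons//.
  by apply: contra ij => /eqP/rcons_inj[->].
- exact: measurable_funTS.
Qed.

End Coding.

(** * Bounds on the quantization error *)

Lemma pairwise_count_le1 (W : eqType) (inc : rel W) (b : pred W) (L : seq W) :
  pairwise inc L ->
  {in L &, forall u v, inc u v -> b u -> b v -> False} ->
  (count b L <= 1)%N.
Proof.
elim: L => //= u L IH /andP[uL pL] Lb.
have {}IH : (count b L <= 1)%N.
  by apply: IH => // v w vL wL; apply: Lb; rewrite inE ?vL ?wL orbT.
case: (boolP (b u)) => [bu|_]; last by rewrite add0n.
rewrite (_ : count b L = 0)%N//; apply/eqP; rewrite -leqn0 leqNgt -has_count; apply/hasPn => v vL; apply/negP => bv.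
apply: (Lb u v _ _ _ bu bv); rewrite ?mem_head// ?inE ?vL ?orbT//.
by move/allP: uL; exact.
Qed.

(** Pigeonhole for the lower bound: each of [k] points spoils at most one cell, so at most [k] cells
    are spoiled. *)
Lemma count_exists_le (W : eqType) (k : nat) (b : nat -> pred W) (p : pred W)
    (L : seq W) :
  (forall u, u \in L -> p u -> exists2 i, (i < k)%N & b i u) ->
  (forall i, (count (b i) L <= 1)%N) -> (count p L <= k)%N.
Proof.
move=> pb b1; rewrite -[leqRHS]card_ord -sum1_card -sum1_count big_mkcond/=.
apply: (@leq_trans (\sum_(u <- L) \sum_(i < k) b i u)).
  rewrite big_seq [leqRHS]big_seq; apply: leq_sum => u uL; case: ifP => // /(pb _ uL)[i ik bi].
  by rewrite (bigD1 (Ordinal ik))//= bi.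
rewrite exchange_big/=; apply: leq_sum => i _.
by apply: leq_trans (b1 i); rewrite -sum1_count [leqRHS]big_mkcond; apply: leq_sum => u _; case: (b i u).
Qed.

Section QuantizationBounds.
Variables (R : realType) (q : nat) (mu : probability (borel 'rV[R]_q) R) (r : R).
Hypothesis r_gt0 : 0 < r.
Implicit Type alpha : set 'rV[R]_q.

Lemma point_dist_ge0 x alpha : 0 <= point_dist x alpha.
Proof.
have [->|/set0P a0] := eqVneq alpha set0; first by rewrite /point_dist image_set0 inf0.
apply: lb_le_inf; first exact: image_nonempty.
by move=> _ [a _ <-]; exact: enorm_ge0.
Qed.

Lemma point_dist_le x alpha a : alpha a -> point_dist x alpha <= enorm (x - a).
Proof.
by move=> aa; apply: ge_inf; [exists 0 => _ [b _ <-]; exact: enorm_ge0|exists a].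
Qed.

Lemma point_dist_measurable alpha : alpha !=set0 ->
  measurable_fun (setT : set (borel 'rV[R]_q)) (fun x => point_dist x alpha).
Proof.
move=> a0; apply: (measurability _ (RGenInftyO.measurableE R)) => _ [_ [t ->] <-].
rewrite setTI; apply: sub_sigma_algebra.
rewrite (_ : _ @^-1` _ = \bigcup_(a in alpha) [set x | enorm (x - a) < t]).
  apply: bigcup_open => a _.
  have c : continuous (fun x : 'rV[R]_q => enorm (x - a)).
    have c : continuous (fun x : 'rV[R]_q => x - a).
      apply: (similarity_continuous ltr01) => x y.
      by rewrite mul1r opprB addrA subrK.
    by move=> x; apply: (continuous_comp (c x)); exact: enorm_continuous.
  rewrite (_ : [set x | _] = (fun x => enorm (x - a)) @^-1` [set` `]-oo, t[]).
    by apply: (continuousP _).1 c _ _; exact: interval_open.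
  by apply/seteqP; split => x /=; rewrite in_itv.
apply/seteqP; split => x /=; rewrite in_itv /=.
  move=> /inf_lt[]; first exact: image_nonempty.
  by move=> _ [a aa <-] h; exists a.
by move=> [a aa /= h]; exact: le_lt_trans (point_dist_le _ aa) h.
Qed.

Variables (W : eqType) (cell : W -> set (borel 'rV[R]_q)) (m dm : W -> R) (L : seq W).
Hypothesis cell_measurable : forall u, u \in L -> measurable (cell u).
Hypothesis cell_nonempty : forall u, u \in L -> cell u !=set0.
Hypothesis mu_cell : forall u, u \in L -> mu (cell u) = (m u)%:E.
Hypothesis dm_ge0 : forall u, u \in L -> 0 <= dm u.
Hypothesis integral_cells : forall f : borel 'rV[R]_q -> \bar R,
  measurable_fun setT f -> (forall x, 0 <= f x)%E ->
  (\int[mu]_x f x = \sum_(u <- L) \int[mu]_(x in cell u) f x)%E.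

Let dist_meas alpha : alpha !=set0 -> measurable_fun (setT : set (borel 'rV[R]_q))
  (fun x => (point_dist x alpha `^ r)%:E).
Proof.
move=> a0; apply/measurable_EFinP.
exact: (measurableT_comp (measurable_powR r) (point_dist_measurable a0)).
Qed.

Lemma quant_err_pow_le k : L != [::] -> (size L <= k)%N ->
  (forall u x y, u \in L -> cell u x -> cell u y -> enorm (x - y) <= dm u) ->
  (quant_err_pow mu r k <= (\sum_(u <- L) m u * dm u `^ r)%:E)%E.
Proof.
move=> Ln Lk diam.
have [pt ptP] : exists pt : W -> 'rV[R]_q, forall u, u \in L -> cell u (pt u).
  exists (fun u => if pselect (cell u !=set0) is left h then xget 0 (cell u) else 0).
  move=> u uL; case: pselect => [[x cx]|]; last by move=> /(_ (cell_nonempty uL)).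
  exact: xgetPex (ex_intro _ x cx).
case: L Ln Lk ptP (@cell_measurable) (@mu_cell) (@dm_ge0) integral_cells diam => // w L' _.
set LL := w :: L' => Lk ptP cm mc d0 ic diam.
pose f i := pt (nth w LL i).
have a0 : f @` `I_(size LL) !=set0 by exists (f 0%N), 0%N.
apply: ge_ereal_inf.
exists (\int[mu]_x (point_dist x (f @` `I_(size LL)) `^ r)%:E)%E.
  exists (f @` `I_(size LL)) => //; split => //.
  apply: card_le_trans (card_image_le _ _) _; apply: subset_card_le => i /= iL.
  exact: leq_trans Lk.
rewrite ic; [|exact: dist_meas|by move=> x; rewrite lee_fin powR_ge0].
rewrite -sumEFin big_seq [leRHS]big_seq; apply: lee_sum => u uL.
apply: (@le_trans _ _ (\int[mu]_(x in cell u) cst (dm u `^ r)%:E x)%E).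
  apply: ge0_le_integral => //; first exact: cm.
  - by move=> x _; rewrite lee_fin powR_ge0.
  - by apply: measurable_funTS; exact: dist_meas.
  - move=> x cx; rewrite lee_fin ge0_ler_powR ?nnegrE ?(ltW r_gt0) ?point_dist_ge0 ?d0//.
    apply: (@le_trans _ _ (enorm (x - pt u))); last by apply: diam => //; exact: ptP.
    apply: point_dist_le; exists (index u LL); first by rewrite /mkset index_mem.
    by rewrite /f nth_index.
rewrite integral_cst; last exact: cm.
by rewrite EFinM -(mc _ uL) muleC; exact: lexx.
Qed.

(* The neighbourhoods of radius [d / (2 * (sqrt q + 1)) * dm u] of the cells are
disjoint, so that at most [k] of them meet [alpha]; the factor [sqrt q + 1] is
there because the triangle inequality is applied to the sup norm. *)
Lemma quant_err_pow_ge (inc : rel W) (d w : R) k :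
  (size L >= k)%N ->
  pairwise inc L -> 0 < d -> (forall u, u \in L -> 0 < dm u) ->
  (forall u v x y, u \in L -> v \in L -> inc u v -> cell u x -> cell v y ->
     d * dm u <= enorm (x - y) /\ d * dm v <= enorm (x - y)) ->
  0 <= w ->
  (forall u, u \in L -> w <= m u * (d / (2 * (Num.sqrt q%:R + 1)) * dm u) `^ r) ->
  (((size L - k)%:R * w)%:E <= quant_err_pow mu r k)%E.
Proof.
move=> kL pL d0 dm0 sep w0 wL.
(* The cardinality bound is used as a map [g] whose values at the indices below [k] cover
   [alpha]. *)
apply: le_ereal_inf_tmp => _ [alpha [a0 /pcard_surjP[g ga]] <-].
pose b := d / (2 * (Num.sqrt q%:R + 1)).
have Q0 : 0 < Num.sqrt q%:R + 1 :> R by rewrite ltr_wpDl// sqrtr_ge0.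
have b0 : 0 < b by rewrite divr_gt0// mulr_gt0.
pose bad_at a u := `[< exists2 x, cell u x & enorm (x - a) < b * dm u >].
pose bad u := has (fun i => bad_at (g i) u) (iota 0 k).
have badk : (count bad L <= k)%N.
  apply: (@count_exists_le _ _ (fun i => bad_at (g i))) => [u uL|i].
    by case/hasP => i; rewrite mem_iota => /andP[_ ik] gi; exists i.
  apply: pairwise_count_le1 pL _ => u v uL vL uv /asboolP[x ux xa] /asboolP[y vy ya].
  have [h1 h2] := sep _ _ _ _ uL vL uv ux vy.
  (* This contradicts the average of the separation bounds [h1] and [h2]. *)
  have xy : enorm (x - y) < d / 2 * (dm u + dm v).
    apply: le_lt_trans (enorm_le_norm _) _.
    have xa' := le_lt_trans (norm_le_enorm _) xa.
    have ya' := le_lt_trans (norm_le_enorm _) ya.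
    have h3 : `|x - y| < b * (dm u + dm v).
      rewrite mulrDr; apply: le_lt_trans (ltrD xa' ya').
      by rewrite [`|y - _|]distrC; apply: le_trans (ler_normD _ _); rewrite addrA subrK.
    have -> : d / 2 * (dm u + dm v) = (Num.sqrt q%:R + 1) * (b * (dm u + dm v)).
      by rewrite /b; field; rewrite lt0r_neq0.
    apply: (@le_lt_trans _ _ ((Num.sqrt q%:R + 1) * `|x - y|)).
      by rewrite ler_wpM2r// lerDl.
    by rewrite ltr_pM2l.
  by nra.
rewrite integral_cells; [|exact: dist_meas|by move=> x; rewrite lee_fin powR_ge0].
have cellge u : u \in L -> ((if bad u then 0 else w)%:E <=
    \int[mu]_(x in cell u) (point_dist x alpha `^ r)%:E)%E.
  move=> uL; case: ifPn => [_|nbad].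
    by apply: integral_ge0 => x _; rewrite lee_fin powR_ge0.
  apply: (@le_trans _ _ (\int[mu]_(x in cell u) cst ((b * dm u) `^ r)%:E x)%E).
    rewrite integral_cst; last exact: cell_measurable.
    apply: (@le_trans _ _ (m u * (b * dm u) `^ r)%:E); first by rewrite lee_fin wL.
    by rewrite EFinM -(mu_cell uL) muleC; exact: lexx.
  apply: ge0_le_integral => //; first exact: cell_measurable.
  - by move=> x _; rewrite lee_fin powR_ge0.
  - by apply: measurable_funTS; exact: dist_meas.
  - move=> x cx; rewrite lee_fin ge0_ler_powR ?nnegrE ?(ltW r_gt0) ?point_dist_ge0//.
      by rewrite mulr_ge0 ?(ltW b0)// ltW// dm0.
    apply: lb_le_inf; first exact: image_nonempty.
    move=> _ [a /ga[i /= ik <-] <-]; rewrite leNgt; apply: contra nbad => ha.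
    by apply/hasP; exists i; rewrite ?mem_iota//; apply/asboolP; exists x.
apply: (@le_trans _ _ (\sum_(u <- L) (if bad u then 0 else w)%:E)%E); last first.
  by rewrite big_seq [leRHS]big_seq; apply: lee_sum => u uL; exact: cellge.
rewrite sumEFin lee_fin (eq_bigr (fun u => if ~~ bad u then w else 0)); last first.
  by move=> u _; case: (bad u).
rewrite -big_mkcond/= big_const_seq iter_addr_0 mulr_natl -[leLHS]mulr_natl -[leRHS]mulr_natl.
rewrite ler_wpM2r// ler_nat leq_subLR.
by rewrite -(count_predC bad L) leq_add2r.
Qed.

End QuantizationBounds.

(** * Dimension and coefficients from two-sided error bounds *)

Section Limits.
Variable R : realType.

Lemma limn_esup_le (u : (\bar R)^nat) (l : \bar R) K :
  (forall n, (K <= n)%N -> (u n <= l)%E) -> (limn_esup u <= l)%E.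
Proof.
move=> ul; rewrite limn_esup_lim (cvg_lim _ (@cvg_esups_inf R u))//.
apply: ge_ereal_inf; exists (esups u K); first by exists K.
by apply: ge_ereal_sup => _ [n /= Kn <-]; exact: ul.
Qed.

Lemma limn_einf_ge (u : (\bar R)^nat) (l : \bar R) K :
  (forall n, (K <= n)%N -> (l <= u n)%E) -> (l <= limn_einf u)%E.
Proof.
move=> ul; rewrite limn_einf_lim (cvg_lim _ (@cvg_einfs_sup R u))//.
apply: le_ereal_sup_tmp; exists (einfs u K); first by exists K.
by apply: le_ereal_inf_tmp => _ [n /= Kn <-]; exact: ul.
Qed.

Lemma bounded_div_ln_cvg0 (y : nat -> R) (M : R) K :
  (forall n, (K <= n)%N -> `|y n| <= M) ->
  (fun n => y n / ln n%:R) @ \oo --> (0 : R).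
Proof.
move=> yM; apply/cvgrPdist_lt => ep ep0.
pose B := (`|M| + 1) / ep.
have B0 : 0 < B by rewrite divr_gt0// ltr_wpDl.
exists (maxn K (Num.truncn (expR B)).+1) => // n /=; rewrite geq_max => /andP[Kn Bn].
have lnB : B < ln n%:R.
  rewrite -[B]expRK ltr_ln ?posrE ?expR_gt0//.
    by apply: (lt_le_trans (truncnS_gt _)); rewrite ler_nat.
  by rewrite ltr0n (leq_trans _ Bn).
have ln0 : 0 < ln (n%:R : R) by exact: lt_trans lnB.
rewrite sub0r normrN normrM normfV (gtr0_norm ln0) ltr_pdivrMr//.
apply: le_lt_trans (yM _ Kn) _; rewrite mulrC -ltr_pdivrMr//.
apply: le_lt_trans lnB; rewrite /B ler_pM2r ?invr_gt0//.
by apply: le_trans (ler_norm _) _; rewrite lerDl.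
Qed.

Variables (q : nat) (mu : probability (borel 'rV[R]_q) R) (r t c C : R) (K : nat).
Hypotheses (r_gt0 : 0 < r) (t_gt0 : 0 < t) (c_gt0 : 0 < c) (C_gt0 : 0 < C).
Hypothesis quant_bounds : forall k, (K <= k)%N ->
  ((c * k%:R `^ - (r / t))%:E <= quant_err_pow mu r k <= (C * k%:R `^ - (r / t))%:E)%E.

Lemma quant_coef_bounds :
  (0 < lower_quant_coef mu r t)%E /\ (upper_quant_coef mu r t < +oo)%E.
Proof.
have kp k : (maxn K 1 <= k)%N -> 0 < k%:R :> R.
  by rewrite geq_max => /andP[_]; rewrite ltr0n.
have kk k : (maxn K 1 <= k)%N -> (k%:R `^ (r / t) * k%:R `^ (- (r / t)))%R = 1 :> R.
  by move=> /kp kp0; rewrite powRN mulfV// gt_eqF// powR_gt0.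
split.
  apply: (@lt_le_trans _ _ c%:E); first by rewrite lte_fin.
  apply: (@limn_einf_ge _ _ (maxn K 1)) => k Kk.
  have -> : (c%:E = (k%:R `^ (r / t))%:E * (c * k%:R `^ - (r / t))%:E)%E.
    by rewrite -EFinM mulrCA kk// mulr1.
  rewrite lee_pmul2l ?lte_fin ?powR_gt0 ?kp//.
  by have := Kk; rewrite geq_max => /andP[/quant_bounds/andP[]].
apply: (@le_lt_trans _ _ C%:E); last by rewrite ltry.
apply: (@limn_esup_le _ _ (maxn K 1)) => k Kk.
have -> : (C%:E = (k%:R `^ (r / t))%:E * (C * k%:R `^ - (r / t))%:E)%E.
  by rewrite -EFinM mulrCA kk// mulr1.
rewrite lee_pmul2l ?lte_fin ?powR_gt0 ?kp//.
by have := Kk; rewrite geq_max => /andP[/quant_bounds/andP[]].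
Qed.

Lemma quant_dim_eq : has_quant_dim mu r t.
Proof.
pose x k := fine (quant_err_pow mu r k).
have xE k : (K <= k)%N -> quant_err_pow mu r k = (x k)%:E.
  move=> /quant_bounds/andP[h1 h2]; rewrite fineK// fin_real//.
  by rewrite (lt_le_trans _ h1) ?ltNyr// (le_lt_trans h2) ?ltry.
have xB k : (K <= k)%N ->
    (c * k%:R `^ (- (r / t)) <= x k <= C * k%:R `^ (- (r / t)))%R.
  by move=> Kk; rewrite -!lee_fin -xE//; exact: quant_bounds.
(* The logarithm of the normalized error; it lies between [ln c] and [ln C]. *)
pose y k := ln (x k) + r / t * ln k%:R.
pose M := `|ln c| + `|ln C|.
have k0 k : (maxn K 2 <= k)%N -> 0 < k%:R :> R.
  by rewrite geq_max => /andP[_ /ltnW]; rewrite ltr0n.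
have x0 k : (maxn K 2 <= k)%N -> 0 < x k.
  move=> Kk; have := k0 _ Kk; move: Kk; rewrite geq_max => /andP[/xB/andP[+ _] _] kp.
  by apply: lt_le_trans; rewrite mulr_gt0// powR_gt0.
have yM k : (maxn K 2 <= k)%N -> `|r^-1 * y k| <= r^-1 * M.
  move=> Kk; have kp := k0 _ Kk; have xp := x0 _ Kk.
  rewrite normrM gtr0_norm ?invr_gt0// ler_pM2l ?invr_gt0//.
  move: Kk; rewrite geq_max => /andP[/xB/andP[h1 h2] _].
  have := h1; rewrite -ler_ln ?posrE ?mulr_gt0 ?powR_gt0//.
  have := h2; rewrite -ler_ln ?posrE ?mulr_gt0 ?powR_gt0//.
  rewrite !lnM ?posrE ?powR_gt0// !ln_powR => h3 h4.
  have a1 := ler_norm (- ln c); have a2 := ler_norm (ln C); rewrite normrN in a1.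
  have a3 := normr_ge0 (ln c); have a4 := normr_ge0 (ln C).
  rewrite /y /M ler_norml; apply/andP; split; lra.
(* The reciprocal of the quotient in the definition of the dimension: minus the logarithm of the
   error equals [z k * ln k], and the term with [y] vanishes in the limit. *)
pose z k := t^-1 - r^-1 * y k / ln k%:R.
have zt : z @ \oo --> t^-1.
  rewrite -[X in _ --> X]subr0; apply: cvgB; first exact: cvg_cst.
  exact: bounded_div_ln_cvg0 yM.
have zV : (fun k => (z k)^-1) @ \oo --> t.
  by rewrite -[X in _ --> X]invrK; apply: cvgV => //; rewrite invr_eq0 gt_eqF.
have z_gt0 : \forall k \near \oo, 0 < z k.
  by apply: (cvgr_gt _ zt); rewrite invr_gt0.
have uE : \forall k \near \oo,
    ((ln k%:R)%:E / - lne (quant_err mu r k) = ((z k)^-1)%:E)%E.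
  near=> k.
  have Kk : (maxn K 2 <= k)%N by near: k; exists (maxn K 2).
  have zp : 0 < z k by near: k.
  have l0 : 0 < ln (k%:R : R).
    by rewrite ln_gt0// ltr1n; move: Kk; rewrite geq_max => /andP[].
  rewrite /quant_err xE; last by move: Kk; rewrite geq_max => /andP[].
  rewrite poweR_EFin lne_EFin ?powR_gt0 ?x0// ln_powR -EFinN.
  have -> : - (r^-1 * ln (x k)) = z k * ln k%:R.
    by rewrite /z /y; field; rewrite !gt_eqF.
  rewrite inver mulf_eq0 !gt_eqF//= -EFinM; congr EFin.
  by rewrite invfM mulrCA mulfV ?mulr1 ?gt_eqF.
suff u_cvg : (fun k => (ln k%:R)%:E / - lne (quant_err mu r k))%E @ \oo --> t%:E.
  by have [h1 h2] := cvg_limn_einf_sup u_cvg; split; [exact: h1 | exact: h2].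
apply: cvg_EFin.
  by near=> k; rewrite (near uE k)//.
apply: cvg_trans zV; apply: near_eq_cvg; near=> k.
by rewrite /= (near uE k).
Unshelve. all: by end_near. Qed.

End Limits.

(** * Growth of matrix powers *)

Section SpectralGrowth.
Variable R : realType.
Local Notation toC := (real_complex R).

Lemma real_complex_norm (z : R[i]) : `|z| = toC (complex.Re `|z|).
Proof. by rewrite normc_def. Qed.

(* One factor is peeled off at a time: with [B' = (A - z) B] one has
[A^(k+1) B = A^k B' + z A^k B], and [|z| <= 1]. *)
Lemma mx_pow_growth n (A : 'M[R[i]]_n.+1) (zs : seq R[i]) (theta : R) :
  1 < theta -> (forall z, z \in zs -> `|z| <= 1) ->
  forall B, horner_mx A (\prod_(z <- zs) ('X - z%:P)) * B = 0 ->
  exists2 D, 0 <= D & forall k i j, `|(A ^+ k * B) i j| <= toC (D * theta ^+ k).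
Proof.
move=> th1; elim: zs => [|z zs IH] zs1 B.
  rewrite big_nil rmorph1 mul1r => ->; exists 0 => // k i j.
  by rewrite mulr0 mxE normr0 mul0r.
rewrite big_cons mulrC rmorphM /= rmorphB /= horner_mx_X horner_mx_C -mulrA => AB.
have [|D D0 HD] := IH _ _ AB.
  by move=> w wz; apply: zs1; rewrite inE wz orbT.
pose M := \sum_i \sum_j complex.Re `|B i j|.
have Re0 (w : R[i]) : 0 <= complex.Re `|w| by rewrite normc_def /= sqrtr_ge0.
have BM i j : `|B i j| <= toC M.
  rewrite real_complex_norm lecR /M (bigD1 i)//= (bigD1 j)//= -addrA lerDl.
  apply: addr_ge0; first by apply: sumr_ge0 => k _; exact: Re0.
  by apply: sumr_ge0 => k _; apply: sumr_ge0 => l _; exact: Re0.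
have M0 : 0 <= M by apply: sumr_ge0 => i _; apply: sumr_ge0 => j _; exact: Re0.
have t0 : 0 < theta - 1 by rewrite subr_gt0.
(* [M] covers the power 0. The recursion adds at most [D * theta ^+ k] at each step, and the
   geometric sum closes because D + D / (theta - 1) = theta D / (theta - 1). *)
exists (M + D / (theta - 1)) => [|k].
  by rewrite addr_ge0// divr_ge0// ltW.
elim: k => [|k IHk] i j.
  rewrite mul1r mulr1; apply: le_trans (BM i j) _.
  by rewrite lecR lerDl divr_ge0// ltW.
have -> : A ^+ k.+1 * B = A ^+ k * ((A - z%:M) * B) + z *: (A ^+ k * B).
  rewrite mulrBl mulrBr exprSr mulrA -[X in X - _ + _]addr0.
  by rewrite -!mulmxE mul_scalar_mx scalemxAr addr0 subrK.
have mxDZ (X Y : 'M[R[i]]_n.+1) : (X + z *: Y) i j = X i j + z * Y i j by rewrite !mxE.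
rewrite mxDZ; apply: le_trans (ler_normD _ _) _; rewrite normrM.
have zle : `|z| <= 1 by apply: zs1; rewrite mem_head.
apply: (@le_trans _ _ (toC (D * theta ^+ k) + toC ((M + D / (theta - 1)) * theta ^+ k))).
  apply: lerD; first exact: HD.
  by apply: le_trans (IHk i j); rewrite ler_piMl.
rewrite -rmorphD lecR exprS -mulrDl mulrA.
rewrite ler_wpM2r ?exprn_ge0// ?(le_trans ler01 (ltW th1))//.
have -> : (M + D / (theta - 1)) * theta = M * theta + D / (theta - 1) + D.
  by field; rewrite gt_eqF.
by rewrite addrC lerD2r lerD2r ler_peMr// ltW.
Qed.

(** Over the complex numbers the characteristic polynomial splits into factors with roots of modulus
    at most 1, and by Cayley-Hamilton it annihilates [A]; [mx_pow_growth] applies with [B = 1]. *)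
Lemma spectral_radius_growth n (A : 'M[R]_n) (theta : R) :
  spectral_radius A <= 1 -> 1 < theta ->
  exists2 D, 0 <= D & forall k i j, `|(A ^+ k) i j| <= D * theta ^+ k.
Proof.
case: n A => [|n] A rA th1; first by exists 0 => // k [].
pose Ac := map_mx toC A.
have [zs zsE] := closed_field_poly_normal (char_poly Ac).
have {}zsE : char_poly Ac = \prod_(z <- zs) ('X - z%:P).
  by rewrite zsE (monicP (char_poly_monic _)) scale1r.
have root_zs z : (z \in zs) = eigenvalue Ac z.
  by rewrite eigenvalue_root_char zsE root_prod_XsubC.
have Re0 (w : R[i]) : 0 <= complex.Re `|w| by rewrite normc_def /= sqrtr_ge0.
have zs1 z : z \in zs -> `|z| <= 1.
  move=> zz; rewrite real_complex_norm -[1]/(toC 1) lecR; apply: le_trans rA.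
  apply: ub_le_sup; last by exists z => //=; rewrite -root_zs.
  (* The supremum dominates its members only for a bounded set; the sum of all moduli is an upper
     bound. *)
  exists (\sum_(w <- zs) complex.Re `|w|) => _ [w /= + <-]; rewrite -/Ac -root_zs => wz.
  by rewrite (big_rem w)//= lerDl sumr_ge0// => v _; exact: Re0.
have hB : horner_mx Ac (\prod_(z <- zs) ('X - z%:P)) * 1 = 0.
  by rewrite -zsE Cayley_Hamilton mul0r.
have [D D0 HD] := mx_pow_growth th1 zs1 hB.
exists D => // k i j; have := HD k i j.
rewrite mulr1 (_ : Ac ^+ k = map_mx toC (A ^+ k)); last by rewrite rmorphXn.
rewrite mxE normc_def /= expr0n addr0 lecR sqrtr_sqr.
by [].
Qed.

End SpectralGrowth.

(** * Comparison of the two exponents *)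

Section PowerSums.
Variables (R : realType) (a : R).
Hypothesis a_gt0 : 0 < a.

Lemma powR_lt1_gt (x : R) : 0 < x < 1 -> a < 1 -> x < x `^ a.
Proof.
move=> /andP[x0 x1] a1; rewrite -[ltLHS]lnK ?posrE// /powR gt_eqF//.
by rewrite ltr_expR ltr_nMl// ln_lt0// x0.
Qed.

(** The power of [x + y] is split in the proportions of [x] and [y]; each share is strictly too
    small because a number in (0,1) increases when raised to a power [a < 1]. *)
Lemma powR_add_lt (x y : R) : 0 < x -> 0 < y -> a < 1 ->
  (x + y) `^ a < x `^ a + y `^ a.
Proof.
move=> x0 y0 a1; have z0 : 0 < x + y by rewrite addr_gt0.
have split_pow u : 0 < u -> u < x + y -> (x + y) `^ a * (u / (x + y)) < u `^ a.
  move=> u0 uz; have -> : u `^ a = (x + y) `^ a * (u / (x + y)) `^ a.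
    rewrite -powRM ?(ltW z0) ?divr_ge0 ?(ltW u0) ?(ltW z0)//.
    by rewrite mulrCA mulfV ?mulr1// gt_eqF.
  rewrite ltr_pM2l ?powR_gt0//; apply: powR_lt1_gt => //.
  by rewrite divr_gt0//= ltr_pdivrMr// mul1r.
have h1 := split_pow _ x0; have h2 := split_pow _ y0.
rewrite ltrDl in h1; rewrite ltrDr in h2.
have := ltrD (h1 y0) (h2 x0); rewrite -mulrDr -mulrDl mulfV ?mulr1// gt_eqF//.
Qed.

Lemma powR_add_le (x y : R) : 0 <= x -> 0 <= y -> a < 1 ->
  (x + y) `^ a <= x `^ a + y `^ a.
Proof.
rewrite le_eqVlt => /predU1P[<-|x0]; first by rewrite add0r lerDr powR_ge0.
rewrite le_eqVlt => /predU1P[<-|y0]; first by rewrite addr0 lerDl powR_ge0.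
by move=> a1; exact/ltW/powR_add_lt.
Qed.

Lemma powR_sum_le (W : eqType) (L : seq W) (x : W -> R) : a < 1 ->
  (forall w, w \in L -> 0 <= x w) ->
  (\sum_(w <- L) x w) `^ a <= \sum_(w <- L) x w `^ a.
Proof.
move=> a1; elim: L => [|w L IH] x0; first by rewrite !big_nil powR0// gt_eqF.
have xL v : v \in L -> 0 <= x v by move=> vL; apply: x0; rewrite inE vL orbT.
rewrite !big_cons; apply: le_trans (powR_add_le _ _ a1) _.
- by apply: x0; rewrite mem_head.
- by rewrite big_seq sumr_ge0.
- by rewrite lerD2l IH.
Qed.

End PowerSums.

(** * Strict gain from equal row sums *)

Section RowGain.
Variables (R : realType) (N : nat) (E : rel 'I_N).
Variables (Q : 'I_(N + N) -> 'I_(N + N) -> R) (c : 'I_N -> 'I_N -> R) (a : R).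
Hypotheses (a_gt0 : 0 < a) (a_lt1 : a < 1).
Hypothesis Q_gt0 : forall x y, E (base x) (base y) -> 0 < Q x y.
Hypothesis Q_row : forall x j, E (base x) j ->
  Q x (lshift N j) + Q x (rshift N j) = c (base x) j.

(** With the first letter fixed, the two lifts of the next letter have equal remaining sums, so only
    their row sum [c] survives and the sum over all lifts becomes one product. *)
Lemma row_sum_edge_prod x u : sorted E (base x :: u) ->
  \sum_(w <- liftseq u) edge_prod Q (x :: w) = edge_prod c (base x :: u).
Proof.
elim: u x => [|j u IH] x; first by rewrite sum_lift_nil.
rewrite [sorted _ _]/= => /andP[xj ju]; rewrite sum_lift_cons.
have IHy y : base y = j ->
    \sum_(w <- liftseq u) edge_prod Q (x :: y :: w) = Q x y * edge_prod c (j :: u).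
  by move=> yj; rewrite -yj -IH ?yj// mulr_sumr.
rewrite !IHy ?base_lshift ?base_rshift// -mulrDl Q_row//.
Qed.

(* The strict inequality [(x + y)^a < x^a + y^a] gains a factor for each letter. *)
Lemma row_gain : exists2 k, 1 < k & forall u, sorted E u ->
  k ^+ (size u).-1 * (\sum_(w <- liftseq u) edge_prod Q w) `^ a <=
  \sum_(w <- liftseq u) edge_prod Q w `^ a.
Proof.
have [d d0 dQ] : exists2 d, 0 < d & forall xj : 'I_(N + N) * 'I_N,
    E (base xj.1) xj.2 -> (1 + d) * c (base xj.1) xj.2 `^ a <=
      Q xj.1 (lshift N xj.2) `^ a + Q xj.1 (rshift N xj.2) `^ a.
  apply: finite_uniform_pos => [xj d d' /andP[d'0 dd] + xE|[x j] /=].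
    by move=> /(_ xE); apply: le_trans; rewrite ler_wpM2r ?powR_ge0// lerD2l.
  have [xj|] := boolP (E (base x) j); last by exists 1.
  have l0 : 0 < Q x (lshift N j) by apply: Q_gt0; rewrite base_lshift.
  have r0 : 0 < Q x (rshift N j) by apply: Q_gt0; rewrite base_rshift.
  have := powR_add_lt l0 r0 a_lt1; rewrite Q_row// => lt.
  have c0 : 0 < c (base x) j `^ a by rewrite powR_gt0// -Q_row// addr_gt0.
  (* The relative excess in the strict subadditivity for this row and block. *)
  exists ((Q x (lshift N j) `^ a + Q x (rshift N j) `^ a) / c (base x) j `^ a - 1).
    by rewrite subr_gt0 ltr_pdivlMr// mul1r.
  by move=> _; rewrite addrC subrK divfK// gt_eqF.
have k1 : 1 < 1 + d by rewrite ltrDl.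
have k0 : 0 <= 1 + d by rewrite ltW// (lt_trans ltr01).
have c_ge0 i j : E i j -> 0 <= c i j.
  move=> ij; rewrite -(base_lshift i) -Q_row ?base_lshift// addr_ge0// ltW// Q_gt0//.
    by rewrite !base_lshift.
  by rewrite base_lshift base_rshift.
have Q_ge0 x y : E (base x) (base y) -> 0 <= Q x y by move=> /Q_gt0/ltW.
have row x u : sorted E (base x :: u) ->
    (1 + d) ^+ size u * edge_prod c (base x :: u) `^ a <=
    \sum_(w <- liftseq u) edge_prod Q (x :: w) `^ a.
  elim: u x => [|j u IH] x; first by rewrite sum_lift_nil mul1r.
  rewrite [sorted _ _]/= => /andP[xj ju]; rewrite sum_lift_cons.
  have IHy y : base y = j ->
      Q x y `^ a * ((1 + d) ^+ size u * edge_prod c (j :: u) `^ a) <=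
      \sum_(w <- liftseq u) edge_prod Q (x :: y :: w) `^ a.
    move=> yj; have juE : sorted E (base y :: u) by rewrite yj.
    have Qxy : 0 <= Q x y by apply: Q_ge0; rewrite yj.
    apply: (@le_trans _ _ (Q x y `^ a * \sum_(w <- liftseq u) edge_prod Q (y :: w) `^ a)).
      by rewrite ler_wpM2l ?powR_ge0//; have := IH y juE; rewrite yj.
    rewrite mulr_sumr big_seq [leRHS]big_seq; apply: ler_sum => w wu.
    rewrite edge_prod_cons powRM//.
    apply: (@edge_prod_ge0 _ _ (fun x y => E (base x) (base y))) => //.
    rewrite (sorted_lift (E := E) (fun _ _ => erefl)) map_cons.
    by move: wu; rewrite mem_liftseq => /eqP->.
  apply: le_trans (lerD (IHy _ (base_lshift j)) (IHy _ (base_rshift j))).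
  rewrite -mulrDl edge_prod_cons powRM ?c_ge0 ?(edge_prod_ge0 c_ge0)//.
  rewrite exprS mulrACA ler_wpM2r ?(dQ (x, j))// mulr_ge0 ?exprn_ge0 ?powR_ge0//.
exists (1 + d) => //; case=> [|i u] uE.
  by rewrite !sum_lift_nil mul1r.
(* The two lifts of the first letter only use weak subadditivity, hence the exponent
   [(size u).-1]. *)
rewrite !sum_lift_cons !row_sum_edge_prod ?base_lshift ?base_rshift// [_.-1]/=.
have ep0 := edge_prod_ge0 c_ge0 uE.
apply: le_trans (lerD (row (lshift N i) u _) (row (rshift N i) u _));
  rewrite ?base_lshift ?base_rshift//.
by rewrite -mulrDr ler_wpM2l ?exprn_ge0//; exact: powR_add_le.
Qed.

End RowGain.

(** * Sums over words against powers of A(a) *)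

Section Comparison.
Variables (R : realType) (N : nat) (e : rel 'I_(N + N)) (E : rel 'I_N).
Variables (chi : 'I_(N + N) -> R) (P : 'M[R]_(N + N)).
Variables (s : 'I_N -> 'I_N -> R) (r : R).
Hypothesis eE : forall a b, e a b = E (base a) (base b).
Hypothesis chi_gt0 : forall a, 0 < chi a.
Hypothesis chi_sum : \sum_a chi a = 1.
Hypothesis P_ge0 : forall a b, 0 <= P a b.
Hypothesis P_gt0 : forall a b, e a b -> 0 < P a b.
Hypothesis P_sum : forall a, \sum_b P a b = 1.
Hypothesis s_ratio : forall i j, E i j -> 0 < s i j < 1.
Hypothesis r_gt0 : 0 < r.

Definition lift_pow_sum a u := \sum_(w <- liftseq u) edge_prod P w `^ a.

Lemma sum_edge_prod_mx (A : 'M[R]_(N + N)) n :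
  \sum_(w <- words 'I_(N + N) n.+1) edge_prod A w = \sum_x \sum_y (A ^+ n) x y.
Proof.
rewrite sum_wordsS; apply: eq_bigr => x _.
elim: n x => [|n IH] x.
  rewrite sum_words0 expr0 (bigD1 x)//= big1 ?addr0 => [|y yx].
    by rewrite mxE eqxx.
  by rewrite mxE eq_sym (negbTE yx).
rewrite sum_wordsS exprS.
transitivity (\sum_z A x z * \sum_y (A ^+ n) z y).
  by apply: eq_bigr => z _; rewrite -IH mulr_sumr.
under [RHS]eq_bigr do rewrite mxE.
by rewrite exchange_big/=; apply: eq_bigr => z _; rewrite mulr_sumr.
Qed.

(** Distributing the power over the lifts leaves a sum of edge products over all paths, that is, of
    entries of a matrix power; inadmissible paths contribute 0 since a matrix entry vanishes. *)
Lemma sum_words_Amx a n :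
  \sum_(u <- words 'I_N n.+1 | sorted E u) lift_pow_sum a u * (edge_prod s u `^ r) `^ a =
  \sum_x \sum_y (Amx e P s r a ^+ n) x y.
Proof.
rewrite -sum_edge_prod_mx -sum_lift_words big_mkcond/=.
have e_ge0 x y : e x y -> 0 <= P x y by [].
have s_ge0 x y : e x y -> 0 <= doubled s x y.
  by rewrite eE => /s_ratio/andP[/ltW].
apply: eq_bigr => u _; case: ifPn => uE; last first.
  apply/esym; rewrite big_seq big1// => w wu.
  move: uE; rewrite -(sorted_liftseq eE wu); case: w {wu} => // x w.
  elim: w x => // y w IH x; rewrite [sorted _ _]/= edge_prod_cons negb_and.
  case/orP => [/negbTE xy|yw]; first by rewrite mxE xy mul0r.
  by rewrite IH ?mulr0.
rewrite /lift_pow_sum mulr_suml big_seq [RHS]big_seq; apply: eq_bigr => w wu.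
have wE : sorted e w by rewrite (sorted_liftseq eE wu).
rewrite -(edge_prod_doubled s wu) -(edge_prod_powR r s_ge0 wE).
have sr_ge0 x y : e x y -> 0 <= doubled s x y `^ r by rewrite powR_ge0.
rewrite -(edge_prod_powR a e_ge0 wE) -(edge_prod_powR a sr_ge0 wE) -edge_prodM.
apply: edge_prod_eq wE => x y xy; rewrite mxE xy powRM ?powR_ge0 ?e_ge0//.
Qed.

Lemma mass_le_sum u : sorted E u -> mass chi P u <= \sum_(w <- liftseq u) edge_prod P w.
Proof.
move=> uE; rewrite /mass big_seq [leRHS]big_seq; apply: ler_sum => w wu.
case: w wu => // x w wu; rewrite ler_piMl ?(chi_le1 chi_gt0 chi_sum)//.
have e_ge0 x' y : e x' y -> 0 <= P x' y by [].
by rewrite (edge_prod_ge0 e_ge0)// (sorted_liftseq eE wu).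
Qed.

Lemma mass_pow_le a u : 0 < a < 1 -> sorted E u ->
  mass chi P u `^ a <= (\sum_(w <- liftseq u) edge_prod P w) `^ a.
Proof.
move=> /andP[a0 a1] uE.
have m0 : 0 <= mass chi P u by exact: (mass_ge0 eE chi_gt0 P_gt0 uE).
rewrite ge0_ler_powR ?nnegrE ?(ltW a0)//; last exact: mass_le_sum.
exact: le_trans (mass_le_sum uE).
Qed.

Lemma mass_pow_le_lift_pow_sum a u : 0 < a < 1 -> sorted E u ->
  mass chi P u `^ a <= lift_pow_sum a u.
Proof.
move=> /[dup] a01 /andP[a0 a1] uE; apply: le_trans (mass_pow_le a01 uE) _.
apply: powR_sum_le => // w wu.
have e_ge0 x y : e x y -> 0 <= P x y by [].
by rewrite (edge_prod_ge0 e_ge0)// (sorted_liftseq eE wu).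
Qed.

(** Stated for a gain [k] per letter to serve twice: [k = 1] for t_r <= s_r, and [k > 1] from
    [row_gain] for the strict inequality. *)
Lemma energy_sum_le a k : 0 < k ->
  (forall u, sorted E u -> k ^+ (size u).-1 * mass chi P u `^ a <= lift_pow_sum a u) ->
  forall n, k ^+ n * (\sum_(u <- words 'I_N n.+1) pow_weight E (energy chi P s r) a u) <=
    \sum_x \sum_y (Amx e P s r a ^+ n) x y.
Proof.
move=> k0 kY n; rewrite -sum_words_Amx mulr_sumr [leRHS]big_mkcond.
rewrite big_seq [leRHS]big_seq; apply: ler_sum => u.
rewrite mem_words => /eqP su; rewrite /pow_weight; case: ifPn => uE; last by rewrite mulr0.
rewrite powRM ?powR_ge0 ?(mass_ge0 eE chi_gt0 P_gt0 uE)// mulrA ler_wpM2r ?powR_ge0//.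
by have := kY u uE; rewrite su.
Qed.

Lemma Amx_sum_growth a theta : spectral_radius (Amx e P s r a) <= 1 -> 1 < theta ->
  exists2 D, 0 <= D & forall n, \sum_x \sum_y (Amx e P s r a ^+ n) x y <= D * theta ^+ n.
Proof.
move=> rA th1; have [D D0 HD] := spectral_radius_growth rA th1.
exists (\sum_(x : 'I_(N + N)) \sum_(y : 'I_(N + N)) D) => [|n].
  by apply: sumr_ge0 => x _; apply: sumr_ge0.
rewrite mulr_suml; apply: ler_sum => x _; rewrite mulr_suml; apply: ler_sum => y _.
exact: le_trans (ler_norm _) (HD _ _ _).
Qed.

Lemma geometric_lower_bound_false (d D q : R) : 0 < d -> 0 <= q < 1 ->
  (forall n, d <= D * q ^+ n) -> False.
Proof.
move=> d0 /andP[q0 q1] dD.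
have [M M0 DM] : exists2 M, 0 < M & D <= M.
  by exists (`|D| + 1); rewrite ?ltr_wpDl// (le_trans (ler_norm _))// lerDl.
have := @cvg_expr R q; rewrite ger0_norm// => /(_ q1).
move=> /cvgrPdist_lt/(_ _ (divr_gt0 d0 M0))[n _ /(_ n (leqnn n))].
rewrite /= sub0r normrN ger0_norm ?exprn_ge0// ltr_pdivlMr// => lt.
have := le_lt_trans (le_trans (dD n) (ler_wpM2r (exprn_ge0 n q0) DM)).
by rewrite mulrC => /(_ _ lt); rewrite ltxx.
Qed.

Lemma energy_sum_gain_false a k d : spectral_radius (Amx e P s r a) <= 1 ->
  0 < d -> 1 < k ->
  (forall u, sorted E u -> k ^+ (size u).-1 * mass chi P u `^ a <= lift_pow_sum a u) ->
  (forall n, d <= \sum_(u <- words 'I_N n.+1) pow_weight E (energy chi P s r) a u) ->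
  False.
Proof.
move=> rA d0 k1 kY dS.
have k0 : 0 < k by exact: lt_trans k1.
(* A rate strictly between 1 and [k]: the matrix powers grow too slowly to match the gain. *)
have th1 : 1 < (1 + k) / 2 by lra.
have [D D0 HD] := Amx_sum_growth rA th1.
apply: (@geometric_lower_bound_false d D ((1 + k) / 2 / k)) => //.
  rewrite divr_ge0 ?(ltW k0) ?(le_trans ler01 (ltW th1))//= ltr_pdivrMr// mul1r; lra.
move=> n; rewrite expr_div_n mulrA ler_pdivlMr ?exprn_gt0// mulrC.
apply: le_trans (HD n); apply: le_trans (energy_sum_le k0 kY n).
by rewrite ler_wpM2l ?exprn_ge0 ?(ltW k0)//; exact: dS.
Qed.

(** If [a < b], the additional power [b - a] of the energy decays geometrically and beats the
    subexponential growth of the sums with exponent [a], so the sums with exponent [b] tend to 0. *)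
Lemma exponent_le a b d : 0 < a < 1 -> spectral_radius (Amx e P s r a) <= 1 ->
  0 < d ->
  (forall n, d <= \sum_(u <- words 'I_N n.+1) pow_weight E (energy chi P s r) b u) ->
  b <= a.
Proof.
move=> a01 rA d0 dS; rewrite leNgt; apply/negP => ab.
have [q /andP[q0 q1] qE] := energy_le_expr eE chi_gt0 chi_sum P_ge0 P_gt0 P_sum s_ratio r_gt0.
pose k := q `^ (b - a).
have k0 : 0 < k by rewrite powR_gt0.
have k1 : k < 1.
  have := @gt0_ltr_powR R (b - a) _ q 1; rewrite powR1 subr_gt0 !nnegrE.
  by apply => //; exact: ltW.
(* The midpoint of 1 and [k^-1]; multiplied by the decay rate [k] it gives [(k + 1) / 2], still
   below 1. *)
have th1 : 1 < (1 + k^-1) / 2.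
  have : 1 < k^-1 by rewrite invf_gt1.
  lra.
have [D D0 HD] := Amx_sum_growth rA th1.
apply: (@geometric_lower_bound_false d D ((1 + k^-1) / 2 * k)) => //.
  rewrite mulr_ge0 ?(ltW k0) ?(le_trans ler01 (ltW th1))//=.
  have -> : (1 + k^-1) / 2 * k = (k + 1) / 2 by field; rewrite gt_eqF.
  lra.
move=> n; apply: le_trans (dS n) _; rewrite exprMn mulrA.
have one u : sorted E u -> 1 ^+ (size u).-1 * mass chi P u `^ a <= lift_pow_sum a u.
  by move=> uE; rewrite expr1n mul1r; exact: mass_pow_le_lift_pow_sum.
have := energy_sum_le ltr01 one n; rewrite expr1n mul1r => SA.
apply: (@le_trans _ _ ((\sum_(u <- words 'I_N n.+1)
   pow_weight E (energy chi P s r) a u) * k ^+ n)); last first.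
  by rewrite ler_wpM2r ?exprn_ge0 ?(ltW k0)//; exact: le_trans SA (HD n).
rewrite mulr_suml big_seq [leRHS]big_seq; apply: ler_sum => u.
rewrite mem_words => /eqP su; rewrite /pow_weight; case: ifPn => uE; last by rewrite mul0r.
have h0 : 0 < energy chi P s r u by exact: (energy_gt0 r eE chi_gt0 P_gt0 s_ratio uE).
have -> : energy chi P s r u `^ b = energy chi P s r u `^ a * energy chi P s r u `^ (b - a).
  rewrite -powRD ?subrKC//; apply/implyP => _; by rewrite gt_eqF.
rewrite ler_wpM2l ?powR_ge0// /k -powR_mulrn ?powR_ge0// -powRrM mulrC powRrM.
rewrite powR_mulrn ?(ltW q0)// ge0_ler_powR ?nnegrE ?subr_ge0 ?(ltW ab) ?(ltW h0) ?exprn_ge0 ?(ltW q0)//.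
by have := qE u uE; rewrite su.
Qed.

End Comparison.

(** * The quantization order *)

Section TupleWords.

Lemma sum_tuple_words (V : nmodType) (I : finType) n (F : seq I -> V) :
  \sum_(t : n.-tuple I) F t = \sum_(u <- words I n) F u.
Proof.
rewrite -(big_map (fun t : n.-tuple I => tval t) xpredT F); apply: perm_big.
apply: uniq_perm; first by rewrite (map_inj_uniq val_inj) index_enum_uniq.
  exact: uniq_words.
move=> u; rewrite mem_words; apply/mapP/idP => [[t _ ->]|un]; first by rewrite size_tuple.
by exists (Tuple un); rewrite ?mem_index_enum.
Qed.

Lemma sum_tuple_lifts (V : nmodType) N n (u : n.-tuple 'I_N)
    (F : seq 'I_(N + N) -> V) :
  \sum_(t : n.-tuple 'I_(N + N) | map (@base N) t == u) F t =
  \sum_(w <- liftseq u) F w.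
Proof.
rewrite big_mkcond (sum_tuple_words n (fun w => if map (@base N) w == u then F w else 0)).
rewrite -big_mkcond -big_filter; apply: perm_big; apply: uniq_perm.
- by rewrite filter_uniq// uniq_words.
- exact: uniq_liftseq.
move=> w; rewrite mem_filter mem_words mem_liftseq andb_idr// => /eqP/(congr1 size).
by rewrite size_map size_tuple => ->.
Qed.

Variables (N : nat) (e : rel 'I_(N + N)) (E : rel 'I_N).
Hypothesis eE : forall a b, e a b = E (base a) (base b).

Lemma mem_lifts n (u : n.-tuple 'I_N) (w : n.-tuple 'I_(N + N)) :
  (w \in lifts u) = (map (@base N) w == u).
Proof.
rewrite inE -[map _ _]/(val (map_tuple (@base N) w)) val_eqE.
apply/forallP/eqP => [h|<- i].
  by apply: eq_from_tnth => i; rewrite tnth_map; apply/eqP; rewrite baseE.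
by rewrite tnth_map -baseE.
Qed.

Lemma mem_Swords n (u : n.-tuple 'I_N) : (u \in Swords e n) = sorted E u.
Proof.
rewrite inE; apply/set0Pn/idP => [[w]|uE].
  by rewrite finset.in_setI mem_lifts inE (sorted_lift eE) => /andP[/eqP->].
have [w wu] := liftseq_neq0 u.
have wn : size w == n by move: wu; rewrite mem_liftseq => /eqP/(congr1 size); rewrite size_map size_tuple => ->.
exists (Tuple wn); rewrite finset.in_setI mem_lifts inE (sorted_liftseq eE wu) uE andbT.
by rewrite -mem_liftseq.
Qed.

Lemma mem_Gam n (u : n.-tuple 'I_N) (w : n.-tuple 'I_(N + N)) : sorted E u ->
  (w \in Gam e u) = (map (@base N) w == u).
Proof.
move=> uE; rewrite finset.in_setI mem_lifts andb_idl// => /eqP wu.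
by rewrite inE (sorted_lift eE) wu.
Qed.

Lemma Gam_sum_energy (R : realType) n (u : n.+1.-tuple 'I_N) (chi : 'I_(N + N) -> R)
    (P : 'I_(N + N) -> 'I_(N + N) -> R) (s : 'I_N -> 'I_N -> R) (r : R) :
  sorted E u ->
  \sum_(w in Gam e u) chi (thead w) * edge_prod P w * edge_prod (doubled s) w `^ r =
  energy chi P s r u.
Proof.
move=> uE; rewrite (eq_bigl _ _ (fun w => mem_Gam w uE)).
rewrite /energy /mass mulr_suml -sum_tuple_lifts; apply: eq_bigr => w wu.
rewrite (@edge_prod_doubled _ _ s u w) ?mem_liftseq//; congr (_ * _).
by case/tupleP: w {wu} => a w; rewrite theadE.
Qed.

Lemma Swords_sum_energy (R : realType) n (chi : 'I_(N + N) -> R)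
    (P : 'I_(N + N) -> 'I_(N + N) -> R) (s : 'I_N -> 'I_N -> R) (r a : R) :
  \sum_(u in Swords e n.+1) (\sum_(w in Gam e u)
     chi (thead w) * edge_prod P w * edge_prod (doubled s) w `^ r) `^ a =
  \sum_(u <- words 'I_N n.+1) pow_weight E (energy chi P s r) a u.
Proof.
rewrite -sum_tuple_words big_mkcond; apply: eq_bigr => u _.
by rewrite mem_Swords /pow_weight; case: ifPn => // uE; rewrite Gam_sum_energy.
Qed.

End TupleWords.

Lemma pow_mx_connect (R : realType) n (E : rel 'I_n) (A : 'M[R]_n) k i j :
  (forall i j, A i j != 0 -> E i j) -> (A ^+ k) i j != 0 -> connect E i j.
Proof.
move=> AE; elim: k i => [|k IH] i.
  by rewrite expr0 mxE; have [->|] := eqVneq i j; rewrite ?connect0// eqxx.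
rewrite exprS mxE => nz.
have [z] : exists z, A i z * (A ^+ k) z j != 0.
  apply/existsP; apply: contraNT nz; rewrite negb_exists => /forallP z0.
  by rewrite big1// => z _; apply/eqP; have := z0 z; rewrite negbK.
rewrite mulf_eq0 negb_or => /andP[/AE iz /IH]; apply: connect_trans.
exact: connect1.
Qed.

Section QuantizationOrder.
Variables (R : realType) (q N : nat) (N_gt1 : (1 < N)%N).
Variables (e : rel 'I_(N + N)) (e_out : forall a, exists b, e a b).
Variables (E : rel 'I_N) (J : 'I_N -> set 'rV[R]_q).
Variables (T : 'I_N -> 'I_N -> 'rV[R]_q -> 'rV[R]_q) (s : 'I_N -> 'I_N -> R).
Hypothesis eE : forall a b, e a b = E (base a) (base b).
Hypothesis J_nonempty : forall i, J i !=set0.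
Hypothesis J_disjoint : trivIset setT J.
Hypothesis J_compact : forall i, compact (J i).
Hypothesis s_ratio : forall i j, E i j -> 0 < s i j < 1.
Hypothesis T_similarity : forall i j, E i j -> similarity (s i j) (T i j).
Hypothesis T_sub : forall i j, E i j -> T i j @` J j `<=` J i.
Hypothesis T_disjoint : trivIset [set ij : 'I_N * 'I_N | E ij.1 ij.2]
  (fun ij => T ij.1 ij.2 @` J ij.2).
Variables (chi : 'I_(N + N) -> R) (P : 'M[R]_(N + N)).
Variable nu : probability (borel (Ginf N_gt1 e_out)) R.
Hypothesis nu_cyl : forall n (w : n.+1.-tuple 'I_(N + N)), w \in Gwords e n.+1 ->
  nu [set x | prefix_word n.+1 x = w] = (chi (thead w) * edge_prod P w)%:E.
Variable mu : probability (borel 'rV[R]_q) R.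
Hypothesis mu_image : forall A : set (borel 'rV[R]_q), measurable A ->
  mu A = nu (coding T J @^-1` A).
Variables (r t c C : R).
Hypotheses (r_gt0 : 0 < r) (t_gt0 : 0 < t) (c_gt0 : 0 < c) (C_gt0 : 0 < C).
Let a := t / (t + r).
Hypothesis families : forall eta, 0 < eta <= 1 -> exists Lam : seq (seq 'I_N),
  [/\ pairwise (@incomparable 'I_N) Lam,
      forall u, u \in Lam ->
        [/\ u != [::], sorted E u & c * eta <= energy chi P s r u < eta],
      c <= (size Lam)%:R * eta `^ a <= C &
      forall G : seq 'I_N -> \bar R,
        (forall u, sorted E u ->
           G u = (\sum_(j | sorted E (rcons u j)) G (rcons u j))%E) ->
        G [::] = (\sum_(u <- Lam) G u)%E].

(** The threshold eta with eta^a = x / k is the one whose antichain has about [k] words; [x] will be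
    chosen to have enough words or few enough. *)
Lemma scale_pow (x k : R) : 0 < x -> 0 < k ->
  ((x / k) `^ a^-1) `^ a = x / k /\
  k * (x / k) `^ a^-1 = x `^ a^-1 * k `^ (- (r / t)).
Proof.
move=> x0 k0; have a0 : a != 0 by rewrite gt_eqF// divr_gt0// addr_gt0.
split; first by rewrite -powRrM mulVf// powRr1// divr_ge0// ltW.
(* This identity is what turns [card * eta] into the order [k^(-r/t)]. *)
have -> : a^-1 = 1 + r / t by rewrite /a; field; rewrite !gt_eqF// addr_gt0.
rewrite powRM ?invr_ge0 ?(ltW x0) ?(ltW k0)// mulrCA; congr (_ * _).
rewrite -[k^-1]powR_inv1 ?(ltW k0)// -powRrM mulN1r opprD powRD; last first.
  by apply/implyP => _; rewrite gt_eqF.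
by rewrite powR_inv1 ?(ltW k0)// mulrA mulfV ?mul1r// gt_eqF.
Qed.

Lemma quant_two_sided : exists c' C' K, [/\ 0 < c', 0 < C' &
  forall k, (K <= k)%N ->
  ((c' * k%:R `^ - (r / t))%:E <= quant_err_pow mu r k <=
   (C' * k%:R `^ - (r / t))%:E)%E].
Proof.
have [D D0 HD] := Jset_diam J_compact s_ratio T_similarity.
have [d d0 Hd] := Jset_separated J_disjoint J_compact s_ratio T_similarity T_sub T_disjoint.
have a0 : 0 < a by rewrite divr_gt0// addr_gt0.
pose b := d / (2 * (Num.sqrt q%:R + 1)).
have b0 : 0 < b by rewrite divr_gt0// mulr_gt0// ltr_wpDl// sqrtr_ge0.
have es_ge0 u : sorted E u -> 0 <= edge_prod s u.
  by apply: edge_prod_ge0 => i j /s_ratio/andP[/ltW].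
have es_gt0 u : sorted E u -> 0 < edge_prod s u.
  by apply: edge_prod_gt0 => i j /s_ratio/andP[].
(* From the index on, [k] is at least [C] and [c / 2], so that both thresholds used below are at
   most 1. *)
exists (b `^ r * c * (c / 2) `^ a^-1), (D `^ r * C `^ a^-1),
  (Num.truncn C + Num.truncn (c / 2)).+1.
split; first by rewrite !mulr_gt0// powR_gt0// divr_gt0.
  by rewrite mulr_gt0// powR_gt0.
move=> k Kk; have k0 : 0 < k%:R :> R by rewrite ltr0n (leq_trans _ Kk).
have Ck : C <= k%:R.
  apply: ltW; apply: lt_le_trans (truncnS_gt _) _; rewrite ler_nat.
  by apply: leq_trans Kk; rewrite ltnS leq_addr.
have ck : c / 2 <= k%:R.
  apply: ltW; apply: lt_le_trans (truncnS_gt _) _; rewrite ler_nat.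
  by apply: leq_trans Kk; rewrite ltnS leq_addl.
have eta01 x : 0 < x -> x <= k%:R -> 0 < (x / k%:R) `^ a^-1 <= 1.
  move=> x0 xk; rewrite powR_gt0 ?divr_gt0//=.
  have := @ge0_ler_powR R a^-1 _ (x / k%:R) 1; rewrite powR1 invr_ge0 ltW// !nnegrE.
  by apply=> //; rewrite ?divr_ge0 ?(ltW x0) ?(ltW k0)// ler_pdivrMr// mul1r.
have intG f : measurable_fun setT f -> (forall x, 0 <= f x)%E ->
    forall u, sorted E u -> (\int[mu]_(x in Jset J T u) f x =
      \sum_(j | sorted E (rcons u j)) \int[mu]_(x in Jset J T (rcons u j)) f x)%E.
  move=> mf f0 u uE.
  exact: (integral_Jset eE J_nonempty J_disjoint J_compact s_ratio T_similarity
    T_sub T_disjoint mu_image mf f0 uE).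
have cells (Lam : seq (seq 'I_N)) f : measurable_fun setT f -> (forall x, 0 <= f x)%E ->
    (forall G : seq 'I_N -> \bar R,
        (forall u, sorted E u ->
           G u = (\sum_(j | sorted E (rcons u j)) G (rcons u j))%E) ->
        G [::] = (\sum_(u <- Lam) G u)%E) ->
    (\int[mu]_x f x = \sum_(u <- Lam) \int[mu]_(x in Jset J T u) f x)%E.
  by move=> mf f0; apply; exact: intG.
have mJ u : sorted E u -> measurable (Jset J T u : set (borel 'rV[R]_q)).
  exact: (Jset_measurable J_compact s_ratio T_similarity).
have mass0 u : sorted E u -> mu (Jset J T u) = (mass chi P u)%:E.
  exact: (mu_Jset eE J_nonempty J_disjoint J_compact s_ratio T_similarity
    T_sub T_disjoint nu_cyl mu_image).
apply/andP; split.
  (* With [x = c / 2] the lower bound on the count gives at least [2 * k] cells, so at least [k] of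
     them stay away from any [k] points. *)
  have c20 : 0 < c / 2 by rewrite divr_gt0.
  have [eta_a eta_k] := scale_pow c20 k0.
  have eta1 := eta01 _ c20 ck.
  have [Lam [inc LamE /andP[Lc _] LamG]] := families eta1.
  have sk : (k * 2 <= size Lam)%N.
    move: Lc; rewrite eta_a -(ler_nat R) natrM => Lc.
    have : c * k%:R * 2 <= (size Lam)%:R * c.
      have -> : c * k%:R * 2 = c * (k%:R * 2) by rewrite mulrA.
      have eq_size : (size Lam)%:R * (c / 2 / k%:R) * (k%:R * 2) = (size Lam)%:R * c.
        by field; rewrite gt_eqF.
      by rewrite -eq_size ler_wpM2r// mulr_ge0// ltW.
    by rewrite -mulrA mulrC ler_pM2r.
  have kL : (k <= size Lam)%N by apply: leq_trans sk; rewrite leq_pmulr.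
  set eta := (c / 2 / k%:R) `^ a^-1 in eta_a eta_k eta1 Lc LamE.
  have /andP[eta0 _] := eta1.
  pose w := b `^ r * (c * eta).
  have w0 : 0 <= w by rewrite mulr_ge0 ?powR_ge0// mulr_ge0// ltW.
  apply: (@le_trans _ _ ((size Lam - k)%:R * w)%:E).
    rewrite lee_fin (_ : _ * _ * _ * _ = k%:R * w).
      by rewrite ler_wpM2r// ler_nat leq_subRL// addnn -muln2.
    by rewrite -mulrA -eta_k /w -/eta; ring.
  apply: (@quant_err_pow_ge R q mu r r_gt0 _ (Jset J T) (mass chi P) (edge_prod s)
    Lam _ _ _ (@incomparable 'I_N) d w k) => //.
  - by move=> u /LamE[_ uE _]; exact: mJ.
  - by move=> u /LamE[_ uE _]; exact: mass0.
  - by move=> f mf f0; exact: cells.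
  - by move=> u /LamE[_ uE _]; exact: es_gt0.
  - move=> u v x y /LamE[_ uE _] /LamE[_ vE _] uv ux vy; split.
      exact: Hd uv uE vE ux vy.
    by rewrite enorm_sym; apply: Hd vE uE vy ux; rewrite /incomparable andbC.
  - move=> u /LamE[_ uE /andP[hu _]].
    rewrite powRM ?es_ge0 ?(ltW b0)// mulrCA ler_wpM2l ?powR_ge0//.
(* With [x = C] the upper bound on the count gives at most [k] cells, one point for each. *)
have [eta_a eta_k] := scale_pow C_gt0 k0.
have eta1 := eta01 _ C_gt0 Ck.
have [Lam [_ LamE /andP[Lc LC] LamG]] := families eta1.
have sk : (size Lam <= k)%N.
  move: LC; rewrite eta_a mulrA ler_pdivrMr// mulrC ler_pM2l//.
  by rewrite ler_nat.
have Ln : Lam != [::].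
  by apply: contraTneq Lc => ->; rewrite mul0r -ltNge.
set eta := (C / k%:R) `^ a^-1 in eta_a eta_k eta1 LamE.
have /andP[eta0 _] := eta1.
apply: (@le_trans _ _ (\sum_(u <- Lam) mass chi P u * (D * edge_prod s u) `^ r)%:E).
  apply: (@quant_err_pow_le R q mu r r_gt0 _ (Jset J T) (mass chi P)
    (fun u => D * edge_prod s u)) => //.
  - by move=> u /LamE[_ uE _]; exact: mJ.
  - by move=> u _; exact: Jset_nonempty.
  - by move=> u /LamE[_ uE _]; exact: mass0.
  - by move=> u /LamE[_ uE _]; rewrite mulr_ge0 ?es_ge0// ltW.
  - by move=> f mf f0; exact: cells.
  - by move=> u x y /LamE[un uE _]; exact: HD.
rewrite lee_fin -mulrA -eta_k -/eta.
apply: (@le_trans _ _ (\sum_(u <- Lam) D `^ r * eta)).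
  rewrite big_seq [leRHS]big_seq; apply: ler_sum => u /LamE[_ uE /andP[_ hu]].
  by rewrite powRM ?es_ge0 ?(ltW D0)// mulrCA ler_wpM2l ?powR_ge0// ltW.
rewrite big_const_seq count_predT iter_addr_0 -[leLHS]mulr_natl mulrCA.
rewrite ler_wpM2l ?powR_ge0// ler_wpM2r ?ler_nat// ltW//.
Qed.

End QuantizationOrder.

Theorem theorem1p5 (R : realType) (q N : nat) (q_gt0 : (0 < q)%N)
  (N_gt1 : (1 < N)%N)
  (e : rel 'I_(N + N)) (e_out : forall a, exists b, e a b)
  (J : 'I_N -> set 'rV[R]_q)
  (J_nonempty : forall i, J i !=set0)
  (J_disjoint : trivIset setT J)
  (J_compact : forall i, compact (J i))
  (J_regular : forall i, closure (interior (J i)) = J i)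
  (T : 'I_N -> 'I_N -> 'rV[R]_q -> 'rV[R]_q) (s : 'I_N -> 'I_N -> R)
  (s_ratio : forall i j : 'I_N, [tuple i; j] \in Swords e 2 -> 0 < s i j < 1)
  (T_similarity : forall i j : 'I_N, [tuple i; j] \in Swords e 2 ->
     similarity (s i j) (T i j))
  (T_sub : forall i j : 'I_N, [tuple i; j] \in Swords e 2 -> T i j @` J j `<=` J i)
  (T_disjoint : trivIset [set ij : 'I_N * 'I_N |
       [tuple ij.1; ij.2] \in Swords e 2]
     (fun ij => T ij.1 ij.2 @` J ij.2))
  (chi : 'I_(N + N) -> R)
  (chi_gt0 : forall a, 0 < chi a) (chi_sum : \sum_a chi a = 1)
  (P : 'M[R]_(N + N))
  (P_ge0 : forall a b, 0 <= P a b) (P_sum : forall a, \sum_b P a b = 1)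
  (P_gt0 : forall a b, 0 < P a b <-> [tuple a; b] \in Gwords e 2)
  (nu : probability (borel (Ginf N_gt1 e_out)) R)
  (nu_cyl : forall n (w : n.+1.-tuple 'I_(N + N)), w \in Gwords e n.+1 ->
     nu [set x | prefix_word n.+1 x = w] =
       (chi (thead w) * edge_prod P w)%:E)
  (mu : probability (borel 'rV[R]_q) R)
  (mu_image : forall A : set (borel 'rV[R]_q), measurable A ->
     mu A = nu (coding T J @^-1` A))
  (r : R) (r_gt0 : 0 < r)
  (P1_irreducible : irreducible_mx (ulsubmx P))
  (P1_two : forall i : 'I_N,
     (2 <= #|[set j : 'I_N | (0 < P (lshift N i) (lshift N j))%R]%SET|)%N)
  (P2_two : forall i : 'I_N,
     (2 <= #|[set j : 'I_N | (0 < P (rshift N i) (rshift N j))%R]%SET|)%N)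
  (M_full : forall i j : 'I_N, Mset e i j = finset.set0 \/
     Mset e i j = four_lifts i j)
  (s_r t_r : R) (s_rP : is_s_r e P s r s_r) (t_rP : is_t_r e P s r chi t_r) :
  [/\ has_quant_dim mu r t_r,
      t_r <= s_r,
      (0 < lower_quant_coef mu r t_r)%E,
      (lower_quant_coef mu r t_r <= upper_quant_coef mu r t_r)%E &
      (upper_quant_coef mu r t_r < +oo)%E] /\
  ((forall i j : 'I_N, [tuple i; j] \in Swords e 2 ->
      P (lshift N i) (lshift N j) + P (lshift N i) (rshift N j) =
      P (rshift N i) (lshift N j) + P (rshift N i) (rshift N j)) \/
   (forall i j : 'I_N, [tuple i; j] \in Swords e 2 ->
      P (lshift N i) (lshift N j) + P (rshift N i) (lshift N j) =
      P (lshift N i) (rshift N j) + P (rshift N i) (rshift N j)) ->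
   t_r < s_r).
Proof.
(* By [M_full] a block of edges is full or empty, so testing the unmarked lifts decides all four. *)
pose E (i j : 'I_N) := e (lshift N i) (lshift N j).
have Gw a b : ([tuple a; b] \in Gwords e 2) = e a b by rewrite inE /= andbT.
have eE a b : e a b = E (base a) (base b).
  have lift4 x y : base x = base a -> base y = base b ->
      [tuple x; y] \in four_lifts (base a) (base b).
    move=> /eqP; rewrite baseE => /orP[] /eqP-> /eqP; rewrite baseE => /orP[] /eqP->;
      by rewrite !inE eqxx ?orbT.
  have [M0|M4] := M_full (base a) (base b).
    have e0 x y : base x = base a -> base y = base b -> e x y = false.
      move=> xa yb; apply/negP => xy; have : [tuple x; y] \in Mset e (base a) (base b).
        by rewrite finset.in_setI lift4// Gw.
      by rewrite M0 finset.in_set0.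
    by rewrite /E !e0 ?base_lshift.
  have e1 x y : base x = base a -> base y = base b -> e x y.
    move=> xa yb; have : [tuple x; y] \in Mset e (base a) (base b) by rewrite M4 lift4.
    by rewrite finset.in_setI Gw => /andP[].
  by rewrite /E !e1 ?base_lshift.
have SwE i j : ([tuple i; j] \in Swords e 2) = E i j by rewrite (mem_Swords eE) /= andbT.
have P_pos a b : e a b -> 0 < P a b by rewrite -Gw => /P_gt0.
have s_E i j : E i j -> 0 < s i j < 1 by rewrite -SwE; exact: s_ratio.
have T_E i j : E i j -> similarity (s i j) (T i j) by rewrite -SwE; exact: T_similarity.
have TJ_E i j : E i j -> T i j @` J j `<=` J i by rewrite -SwE; exact: T_sub.
have Td_E : trivIset [set ij : 'I_N * 'I_N | E ij.1 ij.2] (fun ij => T ij.1 ij.2 @` J ij.2).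
  by move: T_disjoint; congr (trivIset _ _); apply/seteqP; split => ij /=; rewrite SwE.
have E_succ i : exists j, E i j.
  by have [b] := e_out (lshift N i); rewrite eE base_lshift; exists (base b).
have E_conn i j : connect E i j.
  have [k _ Pk] := P1_irreducible i j.
  apply: (@pow_mx_connect _ _ _ (ulsubmx P) k) => [x y|]; last by rewrite gt_eqF.
  rewrite !mxE => nz; rewrite /E -Gw; apply/P_gt0.
  by rewrite lt_neqAle P_ge0 eq_sym nz.
have inh : 'I_N := Ordinal (ltnW N_gt1).
have [C0 C00 h_le] := energy_cat_le eE chi_gt0 P_ge0 P_pos P_sum s_E r_gt0.
have [c0 c00 h_ge] := energy_cat_ge eE chi_gt0 chi_sum P_ge0 P_pos s_E r_gt0.
have h_gt0 := energy_gt0 r eE chi_gt0 P_pos s_E.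
have h_nil := energy_nil chi P s r.
have h_small := energy_small eE chi_gt0 chi_sum P_ge0 P_pos P_sum s_E r_gt0.
have [t0 growth0] := t_rP; have [s0 sA] := s_rP.
pose a := t_r / (t_r + r); pose b := s_r / (s_r + r).
have a0 : 0 < a by rewrite divr_gt0// addr_gt0.
have b01 : 0 < b < 1.
  by rewrite divr_gt0 ?addr_gt0//= ltr_pdivrMr ?addr_gt0// mul1r ltrDl.
have rA : spectral_radius (Amx e P s r b) <= 1 by rewrite sA.
have growth : (fun n : nat => n.+1%:R^-1 *
    ln (\sum_(u <- words 'I_N n.+1) pow_weight E (energy chi P s r) a u)) @ \oo --> (0 : R).
  rewrite (_ : (fun _ => _) = (fun n : nat => n.+1%:R^-1 *
     ln (\sum_(u in Swords e n.+1)
           (\sum_(w in Gam e u)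
              chi (thead w) * edge_prod P w * edge_prod (doubled s) w `^ r) `^ a)))//.
  by apply/funext => n; rewrite (Swords_sum_energy eE).
have [d d0 dS] := pow_weight_sum_ge c00 C00 a0 h_gt0 h_nil h_le h_ge E_conn E_succ inh growth.
have [c [C [c_gt0 C_gt0 fam]]] := stopping_family c00 C00 a0 h_gt0 h_nil h_le h_ge
  h_small E_conn E_succ inh growth.
have [c' [C' [K [c'0 C'0 bnd]]]] := quant_two_sided eE J_nonempty J_disjoint J_compact s_E T_E
  TJ_E Td_E nu_cyl mu_image r_gt0 t0 c_gt0 C_gt0 fam.
have t_le_s : t_r <= s_r.
  have := exponent_le eE chi_gt0 chi_sum P_ge0 P_pos P_sum s_E r_gt0 b01 rA d0
    (fun n => dS n.+1).
  (* The map x / (x + r) is increasing, so the comparison of [a] and [b] passes to [t_r] and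
     [s_r]. *)
  rewrite ler_pdivrMr ?addr_gt0// mulrAC ler_pdivlMr ?addr_gt0// !mulrDr.
  by rewrite [s_r * t_r]mulrC lerD2l ler_pM2r.
have [low upp] := quant_coef_bounds c'0 bnd.
split; first split => //.
- exact: quant_dim_eq bnd.
- exact: limn_einf_sup.
(* If [t_r = s_r], the exponents [a] and [b] coincide, and the lower bound [dS] on the energy sums
   contradicts any gain [k > 1] against the matrix powers. *)
move=> HH; rewrite lt_neqAle t_le_s andbT; apply/negP => /eqP ts.
have ab : a = b by rewrite /a /b ts.
have gain k : 1 < k ->
    (forall u, sorted E u -> k ^+ (size u).-1 * (\sum_(w <- liftseq u) edge_prod P w) `^ b <=
      \sum_(w <- liftseq u) edge_prod P w `^ b) -> False.
  move=> k1 kS.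
  apply: (energy_sum_gain_false (k := k) (d := d) (a := b) eE chi_gt0 P_ge0 P_pos s_E rA d0 k1).
    move=> u uE; apply: le_trans (kS u uE); rewrite ler_wpM2l ?exprn_ge0 ?(ltW (lt_trans _ k1))//.
    exact: (mass_pow_le eE chi_gt0 chi_sum P_ge0 P_pos).
  by move=> n; rewrite -ab; exact: dS.
have /andP[b0 b1] := b01.
case: HH => H.
  (* Row sums read off the upper row of each block; [H] gives the same value for the lower row. *)
  pose c1 i j := P (lshift N i) (lshift N j) + P (lshift N i) (rshift N j).
  have [k k1 kS] : exists2 k, 1 < k & forall u, sorted E u ->
      k ^+ (size u).-1 * (\sum_(w <- liftseq u) edge_prod P w) `^ b <=
      \sum_(w <- liftseq u) edge_prod P w `^ b.
    apply: (row_gain (c := c1)) => // [x y xy|x j xj]; first by apply: P_pos; rewrite eE.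
    have : base x == base x by []; rewrite baseE /c1 => /orP[] /eqP -> ;
      rewrite ?base_lshift ?base_rshift// H// SwE//.
  exact: gain k1 kS.
(* For columns, transpose [P] and reverse the words. *)
pose c2 i j := P (lshift N j) (lshift N i) + P (rshift N j) (lshift N i).
have [k k1 kS] : exists2 k, 1 < k & forall u, sorted (fun i j => E j i) u ->
    k ^+ (size u).-1 * (\sum_(w <- liftseq u) edge_prod (fun x y => P y x) w) `^ b <=
    \sum_(w <- liftseq u) edge_prod (fun x y => P y x) w `^ b.
  apply: (row_gain (c := c2)) => // [x y xy|x j xj]; first by apply: P_pos; rewrite eE.
  have : base x == base x by []; rewrite baseE /c2 => /orP[] /eqP -> ;
    rewrite ?base_lshift ?base_rshift// H// SwE//.
apply: (gain k k1) => u uE; have := kS (rev u).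
rewrite rev_sorted size_rev !sum_lift_rev => /(_ uE).
under eq_bigr do rewrite edge_prod_rev.
by under [X in _ <= X -> _]eq_bigr do rewrite edge_prod_rev.
Qed.
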